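(* Let $G_m$ be a bounded Vilenkin group, let $\{q_k:k\ge0\}$ be a non-increasing sequence of non-negative numbers with $q_0>0$, and let $T_n$ be the corresponding $T$ means. a) The maximal operator $T^*f:=\sup_{n\in\mathbb{N}_+}|T_nf|$ is bounded from the Hardy space $H_{1/2}$ to the space $weak\text{-}L_{1/2}$. b) Let $0<p<1/2$ and suppose in addition that for some constant $c>0$ $$\frac{q_{n+1}}{Q_{n+2}}\ge\frac cn,\qquad n\in\mathbb{N}_+ .$$ Then there exists a martingale $f\in H_p$ such that $$\sup_{n\in\mathbb{N}_+}\|T_nf\|_{weak\text{-}L_p}=\infty .$$
   Context: Let $m=(m_0,m_1,\ldots)$ be a fixed sequence of integers $m_k\ge 2$ with $\sup_k m_k<\infty$. $G_m=\prod_{k\ge0}Z_{m_k}$, $Z_{m_k}=\{0,\ldots,m_k-1\}$ the integers mod $m_k$, is the bounded Vilenkin group with product (of discrete) topology and normalized Haar measure $\mu$. $I_0(x)=G_m$, $I_n(x)=\{y\in G_m: y_0=x_0,\ldots,y_{n-1}=x_{n-1}\}$. $M_0=1$, $M_{k+1}=m_kM_k$; every $n\in\mathbb{N}$ is uniquely $n=\sum_j n_jM_j$ with $n_j\in Z_{m_j}$. $r_k(x)=\exp(2\pi i x_k/m_k)$ and $\psi_n=\prod_k r_k^{n_k}$ (Vilenkin system). $\mathbb{N}_+=\{1,2,\ldots\}$, $\mathbb{N}=\mathbb{N}_+\cup\{0\}$. For $f\in L_1(G_m)$: $\widehat f(n)=\int_{G_m} f\overline{\psi_n}\,d\mu$;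 $S_0f=0$, $S_nf=\sum_{k=0}^{n-1}\widehat f(k)\psi_k$. $\|g\|_p=(\int_{G_m}|g|^pd\mu)^{1/p}$ and $\|g\|_{weak\text{-}L_p}=\sup_{\lambda>0}\lambda\,\mu(|g|>\lambda)^{1/p}$. Let $\mathcal F_n$ be the $\sigma$-algebra generated by the sets $I_n(x)$, $x\in G_m$. A martingale is a sequence $f=(f^{(n)}:n\in\mathbb{N})$ of integrable functions with $f^{(n)}$ $\mathcal F_n$-measurable and $S_{M_n}f^{(l)}=f^{(n)}$ for $n\le l$. $f^*=\sup_n|f^{(n)}|$; $H_p$ ($0<p<\infty$) is the space of martingales with $\|f\|_{H_p}:=\|f^*\|_p<\infty$. For a martingale, $\widehat f(i)=\lim_{k\to\infty}\int_{G_m}f^{(k)}\overline{\psi_i}\,d\mu$ and $S_nf=\sum_{k=0}^{n-1}\widehat f(k)\psi_k$. $T$ means: $T_nf=\frac1{Q_n}\sum_{k=0}^{n-1}q_kS_kf$ with $Q_n=\sum_{k=0}^{n-1}q_k$. An operator $A$ is bounded from $H_p$ to a space $X$ if there is a constant $C$ with $\|Af\|_X\le C\|f\|_{H_p}$ for all $f\in H_p$. *)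

(* Defs.v *)
From HB Require Import structures.
From mathcomp Require Import all_boot all_order all_algebra.
From mathcomp Require Import complex.
From mathcomp Require Import all_classical all_reals all_analysis.

Set Implicit Arguments.
Unset Strict Implicit.
Unset Printing Implicit Defensive.

Import Order.TTheory GRing.Theory Num.Theory.
Import numFieldNormedType.Exports.
Import ComplexField.
Local Open Scope classical_set_scope.
Local Open Scope ring_scope.

(* The group G_m with its product topology and its Borel sigma-algebra.
   ['Z_n] is the ring of integers modulo [n] for [1 < n] only: these definitions
   are meant for sequences [m] all of whose terms are at least 2. *)
Definition vilenkin (m : nat -> nat) : Type :=
  prod_topology (fun k => discrete_topology 'Z_(m k)).

HB.instance Definition _ m := Topological.on (vilenkin m).
HB.instance Definition _ m :=
  isPointed.Build (vilenkin m) (fun k => 0 : 'Z_(m k)).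
HB.instance Definition _ m :=
  Measurable.copy (vilenkin m) (g_sigma_algebraType (@open (vilenkin m))).

Section vilenkin_group.
Variable m : nat -> nat.
Implicit Types (n k : nat) (x y a : vilenkin m).

Definition vcoord x k : 'Z_(m k) := x k.

Definition vadd a x : vilenkin m := fun k => vcoord a k + vcoord x k.

Definition vcylinder n x : set (vilenkin m) :=
  [set y | forall k, (k < n)%N -> vcoord y k = vcoord x k].

Definition vcylinders n : set (set (vilenkin m)) := range (vcylinder n).

Definition vbase n : nat := (\prod_(k < n) m k)%N.

(* The coefficient of [vbase k] in the expansion of [n] in the mixed radix
   system [m], see [vdigit_lt] and [vdigit_sum]. *)
Definition vdigit n k : nat := ((n %/ vbase k) %% m k)%N.

End vilenkin_group.

Section vdigit_theory.
Variable m : nat -> nat.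
Hypothesis m_ge2 : forall k, (2 <= m k)%N.

Lemma vbase_gt n : (n < vbase m n)%N.
Proof.
elim: n => [|n IHn]; first by rewrite /vbase big_ord0.
rewrite /vbase big_ord_recr /= -/(vbase m n).
apply: (@leq_trans (vbase m n * 2)%N); last by rewrite leq_mul2l m_ge2 orbT.
by rewrite muln2 -addnn -(addn1 n.+1) leq_add// (leq_trans _ IHn).
Qed.

Lemma vdigit_lt n k : (vdigit m n k < m k)%N.
Proof. by rewrite ltn_mod (leq_trans _ (m_ge2 k)). Qed.

Lemma vdigit_eq0 n k : (n <= k)%N -> vdigit m n k = 0%N.
Proof.
by move=> nk; rewrite /vdigit divn_small ?mod0n// (leq_ltn_trans nk)// vbase_gt.
Qed.

Lemma vdigit_sum n : n = (\sum_(k < n) vdigit m n k * vbase m k)%N.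
Proof.
suff H N : (\sum_(k < N) vdigit m n k * vbase m k = n %% vbase m N)%N.
  by rewrite H modn_small// vbase_gt.
elim: N => [|N IHN]; first by rewrite big_ord0 /vbase big_ord0 modn1.
rewrite big_ord_recr /= IHN [in RHS]/vbase big_ord_recr /= -/(vbase m N).
set b := vbase m N; rewrite /vdigit -/b.
have b_gt0 : (0 < b)%N by exact: leq_ltn_trans (vbase_gt N).
have nE : n = (n %/ b %/ m N * (b * m N) +
    ((n %/ b) %% m N * b + n %% b))%N.
  rewrite addnA (mulnC b) mulnA -mulnDl -divn_eq; exact: divn_eq.
rewrite [in RHS]nE modnMDl [RHS]modn_small; first exact: addnC.
have lt_m : ((n %/ b) %% m N < m N)%N := vdigit_lt n N.
apply: (@leq_trans (((n %/ b) %% m N).+1 * b)%N); last first.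
  by rewrite mulnC leq_mul2l lt_m orbT.
by rewrite mulSn addnC ltn_add2r ltn_mod.
Qed.

End vdigit_theory.

Section vilenkin_fourier.
Context {R : realType} {m : nat -> nat}.
Local Notation C := R[i].
Local Notation G := (vilenkin m).
Implicit Types (mu : probability G R) (f g : G -> C) (F : nat -> G -> C).

(* Translation invariance: since [mu] is a probability, it is then the
   normalized Haar measure of the group. *)
Definition haar mu : Prop := forall (a : G) (A : set G),
  measurable A -> mu (vadd a @` A) = mu A.

Definition rademacher k (x : G) : C :=
  let t := 2 * pi * (vcoord x k : nat)%:R / (m k)%:R in Complex (cos t) (sin t).

(* The infinite product is finite: its factors with [n <= k] are 1, by
   [vdigit_eq0]. *)
Definition vilenkin_fun n (x : G) : C :=
  \prod_(k < n) rademacher k x ^+ vdigit m n k.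

(* Complex functions are integrated, and tested for integrability and
   measurability, through their real and imaginary parts. *)
Definition cintegrable mu f : Prop :=
  mu.-integrable setT (EFin \o (fun x => complex.Re (f x))) /\
  mu.-integrable setT (EFin \o (fun x => complex.Im (f x))).

Definition cintegral mu f : C :=
  Complex (\int[mu]_x complex.Re (f x)) (\int[mu]_x complex.Im (f x)).

Definition fourier mu f n : C :=
  cintegral mu (fun x => f x * conjc (vilenkin_fun n x)).

Definition partial_sum (c : nat -> C) n (x : G) : C :=
  \sum_(k < n) c k * vilenkin_fun k x.

Definition filtration_measurable n f : Prop :=
  measurable_fun (setT : set (g_sigma_algebraType (vcylinders n)))
    (fun x => complex.Re (f x)) /\
  measurable_fun (setT : set (g_sigma_algebraType (vcylinders n)))
    (fun x => complex.Im (f x)).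

Definition martingale mu F : Prop :=
  [/\ forall n, cintegrable mu (F n),
      forall n, filtration_measurable n (F n) &
      forall n l, (n <= l)%N ->
        partial_sum (fourier mu (F l)) (vbase m n) =1 F n].

Definition martingale_fourier mu F i : C :=
  limn (fun k => fourier mu (F k) i : C^o).

(* Suprema are taken in [\bar R], since they may be infinite at some points. *)
Definition maximal_fun F (x : G) : \bar R :=
  ereal_sup (range (fun n => (Normc.normc (F n x))%:E)).

Definition hardy_norm mu (p : R) F : \bar R :=
  Lnorm mu p%:E (maximal_fun F).

Definition hardy mu (p : R) F : Prop :=
  martingale mu F /\ (hardy_norm mu p F < +oo)%E.

Definition weak_Lnorm mu (p : R) (g : G -> \bar R) : \bar R :=
  ereal_sup [set (l%:E * poweR (mu [set x | l%:E < `|g x|]) p^-1)%E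
            | l in [set l : R | 0 < l]].

Definition Tweight (q : nat -> R) n : R := \sum_(k < n) q k.

Definition Tmean mu (q : nat -> R) F n (x : G) : C :=
  ((Tweight q n)^-1)%:C%C *
  \sum_(k < n) (q k)%:C%C * partial_sum (martingale_fourier mu F) k x.

Definition Tmean_abs mu (q : nat -> R) F n (x : G) : \bar R :=
  (Normc.normc (Tmean mu q F n x))%:E.

Definition Tmaximal mu (q : nat -> R) F (x : G) : \bar R :=
  ereal_sup [set Tmean_abs mu q F n x | n in [set n | (0 < n)%N]].

End vilenkin_fourier.

(* Main.v *)
(* a) Abel summation bounds [T^* f] by the maximal Fejer operator.  A martingale
   with frozen level [N] is a function on a finite group, where the stopping times
   of its maximal function split it into a part bounded by a multiple of [lambda]
   and atoms of height [4^k lambda].  An atom on a cylinder of order [n] only sees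
   Fejer kernels of order at least [M_n], whose conditional expectation of order
   [n] is dominated by a fixed multiple of [M_n V_n], with [V_n = M_k M_l / M_n^2]
   up to a constant at points whose first nonzero coordinates are [k < l].  The
   mean of [min (V_n, u^2)] is [O (u / M_n)]; as truncation at [lambda] is
   subadditive, Markov's inequality sums the atoms into the weak-type bound.

   b) For a lacunary sum of multiples [u_k] of the atoms
   [D_(M_(n_k + 1)) - D_(M_(n_k))], the mean of order [M_(n_k) + 2] has a last
   term of constant modulus at least [c u_k / M_(n_k)], while the other terms only
   involve the previous atoms.  As [p < 1/2], the indices [n_k] can be chosen so
   large that the [u_k] make these means tend to infinity everywhere and the sum
   stays in [H_p]. *)
Require Import Defs.
From mathcomp Require Import all_boot all_order all_algebra.
From mathcomp Require Import complex ring lra zify.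
From mathcomp Require Import all_classical all_reals all_analysis measurable_realfun.
Import Order.TTheory GRing.Theory Num.Theory.
Import numFieldNormedType.Exports.
Local Open Scope classical_set_scope.
Local Open Scope ring_scope.
Set Implicit Arguments.
Unset Strict Implicit.
Unset Printing Implicit Defensive.

(** * Averages over coordinates *)

(** The exponent 1/2 in a) is decided by the truncation. Untruncated, [V_n] has mean of order
    [1 / M_n], so the atoms of height [4^k lambda] would cost [4^k mu(f^* > 4^k lambda)], and these
    sum to an [H_1] quantity. Truncating such an atom at [lambda] truncates [V_n] at [u^2] with
    [u = 2^-k]; the mean gains the factor [u], the cost drops to [2^k mu(f^* > 4^k lambda)], and the
    sum over [k] is dominated by the integral of the square root of [f^* / lambda]. There is no
    logarithmic loss because the contributions of the pairs of coordinates to the truncated mean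
    decay geometrically away from the index where [M] crosses [u M_n]. A martingale may jump far
    beyond a threshold when it first exceeds it. Stopping one order earlier keeps the stopped part
    below the threshold; as [m] is bounded, this enlarges the stopped set at most by the factor
    [sup m]. In b) the lower bound on [q] lets [u_k] be a multiple of [M_(n_k)] only, so the [p]-th
    power of the [H_p] size of an atom is of order [M_(n_k)^(2p - 1)], which is small for [n_k]
    large exactly when [p < 1/2]. *)

Section coordinates.
Variable m : nat -> nat.
Hypothesis m_ge2 : forall k, (2 <= m k)%N.
Local Notation G := (vilenkin m).
Implicit Types (x y z : G) (k n : nat).

Definition vunit k (a : nat) : G := fun q => (if q == k then a else 0)%N%:R : 'Z_(m q).

Lemma vilenkin_ext x y : (forall k, vcoord x k = vcoord y k) -> x = y.
Proof. by move=> xy; apply: functional_extensionality_dep. Qed.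

Lemma vaddC x y : vadd x y = vadd y x.
Proof. by apply: vilenkin_ext => k; rewrite /vadd /vcoord addrC. Qed.

Lemma vaddA x y z : vadd x (vadd y z) = vadd (vadd x y) z.
Proof. by apply: vilenkin_ext => k; rewrite /vadd /vcoord addrA. Qed.

Lemma vaddCA x y z : vadd x (vadd y z) = vadd y (vadd x z).
Proof. by rewrite !vaddA (vaddC x). Qed.

Lemma vunitD k a b x : vadd (vunit k a) (vadd (vunit k b) x) = vadd (vunit k (a + b)) x.
Proof.
apply: vilenkin_ext => q; rewrite /vadd /vunit /vcoord addrA -natrD.
by case: eqP.
Qed.

Lemma vunit0 k x : vadd (vunit k 0) x = x.
Proof. by apply: vilenkin_ext => q; rewrite /vadd /vunit /vcoord; case: eqP; rewrite add0r. Qed.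

Lemma vunit_period k x : vadd (vunit k (m k)) x = x.
Proof.
apply: vilenkin_ext => q; rewrite /vadd /vunit /vcoord; case: eqP => [->|]; last by rewrite add0r.
by rewrite pchar_Zp ?add0r//; exact: m_ge2.
Qed.

Lemma vcoord_vadd x y k : vcoord (vadd x y) k = vcoord x k + vcoord y k.
Proof. by []. Qed.

Lemma vcoord_vunit k a x q :
  vcoord (vadd (vunit k a) x) q = (if q == k then a else 0)%N%:R + vcoord x q.
Proof. by []. Qed.

Lemma vcoord_vunit_neq k a x q : q != k -> vcoord (vadd (vunit k a) x) q = vcoord x q.
Proof. by move=> qk; rewrite vcoord_vunit (negbTE qk) add0r. Qed.

(** This replaces measurability for the sigma-algebra of order [n]; values in any type are allowed
    so that it also covers predicates. *)
Definition level {T} n (g : G -> T) :=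
  forall x y, (forall k, (k < n)%N -> vcoord x k = vcoord y k) -> g x = g y.

Lemma level_le {T} n n' (g : G -> T) : (n <= n')%N -> level n g -> level n' g.
Proof. by move=> nn' lg x y xy; apply: lg => k kn; apply: xy; exact: leq_trans nn'. Qed.

Lemma level_vadd {T} n (g : G -> T) a : level n g -> level n (fun x => g (vadd a x)).
Proof. by move=> lg x y xy; apply: lg => k kn; rewrite !vcoord_vadd xy. Qed.

Lemma level_sum {K : nmodType} {I : Type} (r : seq I) (P : pred I) (F : I -> G -> K) n :
  (forall i, P i -> level n (F i)) -> level n (fun x => \sum_(i <- r | P i) F i x).
Proof. by move=> lF x y xy; apply: eq_bigr => i Pi; apply: lF. Qed.

Definition coord_inv {T} k (g : G -> T) := forall x, g (vadd (vunit k 1) x) = g x.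

Lemma coord_invn {T} k (g : G -> T) a x : coord_inv k g -> g (vadd (vunit k a) x) = g x.
Proof.
by move=> gk; elim: a => [|a IH]; rewrite ?vunit0// -add1n -vunitD gk.
Qed.

Lemma level_coord_inv {T} n k (g : G -> T) : (n <= k)%N -> level n g -> coord_inv k g.
Proof.
move=> nk lg x; apply: lg => q qn; rewrite vcoord_vunit_neq// ltn_eqF//.
exact: leq_trans nk.
Qed.

End coordinates.

Section averages.
Variable m : nat -> nat.
Hypothesis m_ge2 : forall k, (2 <= m k)%N.
Local Notation G := (vilenkin m).
Variable K : numFieldType.
Implicit Types (x y z : G) (k n : nat) (f g : G -> K) (s : seq nat).

Definition avg1 k g x : K := (m k)%:R^-1 * \sum_(a < m k) g (vadd (vunit m k a) x).

(* On functions of the first [N] coordinates, [avg (iota 0 N)] is the Haar integral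
   (see [integral_level]) and [avg (iota n (N - n))] is the conditional expectation
   given the first [n] coordinates. *)
Definition avg s g : G -> K := foldr avg1 g s.

Lemma avg_cons k s g : avg (k :: s) g = avg1 k (avg s g).
Proof. by []. Qed.

Lemma avg_seq1 k g : avg [:: k] g = avg1 k g.
Proof. by []. Qed.

Let mk_neq0 k : (m k)%:R != 0 :> K.
Proof. by rewrite pnatr_eq0 -lt0n (leq_trans _ (m_ge2 k)). Qed.

Lemma avg_cat s1 s2 g : avg (s1 ++ s2) g = avg s1 (avg s2 g).
Proof. by rewrite /avg foldr_cat. Qed.

Lemma eq_avg s f g : f =1 g -> avg s f =1 avg s g.
Proof. by move=> fg x; rewrite (_ : f = g)//; apply/funext. Qed.

Lemma avg_vadd s g a x : avg s (fun y => g (vadd a y)) x = avg s g (vadd a x).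
Proof.
elim: s x => // k s IH x; rewrite avg_cons /avg1; congr (_ * _).
by apply: eq_bigr => i _; rewrite IH vaddCA.
Qed.

(** The shift rotates the sum cyclically: its last term wraps around to the index 0, by
    [vunit_period]. *)
Lemma avg1_inv k g : coord_inv k (avg1 k g).
Proof.
move=> x; rewrite /avg1; congr (_ * _).
under eq_bigr do rewrite vaddCA vunitD.
case: (m k) (vunit_period m_ge2 k x) => [|n] period; first by rewrite !big_ord0.
rewrite big_ord_recr big_ord_recl /= add1n period vunit0 addrC; congr (_ + _).
Qed.

Lemma coord_inv_avg1 k q g : coord_inv q g -> coord_inv q (avg1 k g).
Proof.
by move=> gq x; rewrite /avg1; congr (_ * _); apply: eq_bigr => i _; rewrite vaddCA gq.
Qed.

Lemma coord_inv_avg s k g : (k \in s) || `[< coord_inv k g >] -> coord_inv k (avg s g).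
Proof.
elim: s => [/= /asboolP//|q s IH]; rewrite avg_cons inE -orbA => /orP[/eqP <-|/IH].
  exact: avg1_inv.
exact: coord_inv_avg1.
Qed.

Lemma mem_coord_inv_avg s k g : k \in s -> coord_inv k (avg s g).
Proof. by move=> ks; apply: coord_inv_avg; rewrite ks. Qed.

Lemma avg_vunit s k g a x : k \in s -> avg s (fun y => g (vadd (vunit m k a) y)) x = avg s g x.
Proof. by move=> ks; rewrite avg_vadd (coord_invn _ _ (mem_coord_inv_avg g ks)). Qed.

Lemma avg_sum s (I : Type) (r : seq I) (P : pred I) (F : I -> G -> K) x :
  avg s (fun y => \sum_(i <- r | P i) F i y) x = \sum_(i <- r | P i) avg s (F i) x.
Proof.
elim: s x => // k s IH x; rewrite avg_cons /avg1.
under eq_bigr do rewrite IH.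
by rewrite exchange_big mulr_sumr.
Qed.

Lemma avgZ s c g x : avg s (fun y => c * g y) x = c * avg s g x.
Proof.
elim: s x => // k s IH x; rewrite avg_cons /avg1.
by under eq_bigr do rewrite IH; rewrite -mulr_sumr mulrCA.
Qed.

Lemma avgZr s c g x : avg s (fun y => g y * c) x = avg s g x * c.
Proof. by rewrite mulrC -avgZ; apply: eq_avg => y; rewrite mulrC. Qed.

Lemma avgD s f g x : avg s (fun y => f y + g y) x = avg s f x + avg s g x.
Proof.
elim: s x => // k s IH x; rewrite !avg_cons /avg1.
by under eq_bigr do rewrite IH; rewrite big_split mulrDr.
Qed.

Lemma avgN s g x : avg s (fun y => - g y) x = - avg s g x.
Proof. by rewrite -mulN1r -avgZ; apply: eq_avg => y; rewrite mulN1r. Qed.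

Lemma avg1_id k g x : coord_inv k g -> avg1 k g x = g x.
Proof.
move=> gk; rewrite /avg1 (eq_bigr (fun=> g x)); last by move=> i _; rewrite coord_invn.
by rewrite sumr_const card_ord -[g x *+ _]mulr_natl mulrA mulVf ?mul1r.
Qed.

Lemma avg_id s g x : (forall k, k \in s -> coord_inv k g) -> avg s g x = g x.
Proof.
elim: s x => // k s IH x sg; rewrite avg_cons avg1_id; first by apply: IH => q qs; apply: sg; rewrite inE qs orbT.
by apply: coord_inv_avg; apply/orP; right; apply/asboolP/sg; rewrite inE eqxx.
Qed.

Lemma avg_cst s (c : K) x : avg s (fun=> c) x = c.
Proof. by rewrite avg_id. Qed.

Lemma avg_mull s f g x : (forall k, k \in s -> coord_inv k f) ->
  avg s (fun y => f y * g y) x = f x * avg s g x.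
Proof.
elim: s x => // k s IH x sf; rewrite avg_cons /avg1.
have fk : coord_inv k f by apply: sf; rewrite inE eqxx.
under eq_bigr => i _.
  rewrite IH; last by move=> q qs; apply: sf; rewrite inE qs orbT.
  rewrite coord_invn//; over.
by rewrite -mulr_sumr mulrCA.
Qed.

Lemma avg_avg1 s k g x : k \in s -> avg s (avg1 k g) x = avg s g x.
Proof.
move=> ks; rewrite /avg1 avgZ avg_sum.
under eq_bigr do rewrite avg_vunit//.
by rewrite sumr_const card_ord -[avg s g x *+ _]mulr_natl mulrA mulVf ?mul1r.
Qed.

Lemma avg_absorb s s' g x : {subset s' <= s} -> avg s (avg s' g) x = avg s g x.
Proof.
elim: s' x => // k s' IH x ss'; rewrite avg_cons.
rewrite avg_avg1; last by apply: ss'; rewrite inE eqxx.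
by apply: IH => q qs; apply: ss'; rewrite inE qs orbT.
Qed.

(** The shift leaves the average unchanged and also multiplies it by [z]. All orthogonality
    relations below come from this. *)
Lemma avg_eq0 s k (z : K) g x : k \in s -> z != 1 ->
  (forall y, g (vadd (vunit m k 1) y) = z * g y) -> avg s g x = 0.
Proof.
move=> ks z1 gz; have : avg s g x = z * avg s g x.
  by rewrite -{1}(avg_vunit g 1 x ks) -avgZ; exact: eq_avg.
move/eqP; rewrite -subr_eq0 -{1}[avg s g x]mul1r -mulrBl mulf_eq0 subr_eq0 eq_sym (negbTE z1) /=.
by move/eqP.
Qed.

Lemma exchange_avg s s' (g : G -> G -> K) x y :
  avg s (fun x => avg s' (g x) y) x = avg s' (fun y => avg s (fun x => g x y) x) y.
Proof.
elim: s x => // k s IH x; rewrite avg_cons /avg1 avgZ avg_sum; congr (_ * _).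
by apply: eq_bigr => i _; rewrite IH.
Qed.

Lemma level_avg s n g : level n g -> level n (avg s g).
Proof.
elim: s => // k s IH /IH lg; rewrite avg_cons /avg1 => x y xy; congr (_ * _).
apply: eq_bigr => i _; apply: lg => q qn.
by rewrite !vcoord_vadd xy.
Qed.

Lemma level_avg1 n g : level n.+1 g -> level n (avg1 n g).
Proof.
move=> lg x y xy.
(* Shifting [x] by [a] in coordinate [n] makes it agree with [y] there, and [avg1 n g] does not
   notice this shift. *)
pose a : nat := (vcoord y n - vcoord x n)%R.
rewrite -(coord_invn a x (avg1_inv n g)).
apply: (level_avg [:: n] lg) => k; rewrite ltnS leq_eqVlt => /orP[/eqP ->|kn].
  by rewrite vcoord_vunit eqxx natr_Zp subrK.
by rewrite vcoord_vunit_neq ?xy// ltn_eqF.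
Qed.

Lemma level_avg_iota n d g : level (n + d) g -> level n (avg (iota n d) g).
Proof.
elim: d n g => [|d IH] n g; first by rewrite addn0.
by rewrite addnS -addSn => lg /=; exact: level_avg1 (IH _ _ lg).
Qed.

Lemma avg_iota0_cst N g x y : level N g -> avg (iota 0 N) g x = avg (iota 0 N) g y.
Proof. by move=> lg; apply: (@level_avg_iota 0). Qed.

(** The full average absorbs the conditional expectation of order [n], out of which the factor of
    level [n] can be taken. *)
Lemma avg_split N n f g x : (n <= N)%N -> level n f ->
  avg (iota 0 N) (fun y => f y * g y) x =
  avg (iota 0 N) (fun y => f y * avg (iota n (N - n)) g y) x.
Proof.
move=> nN lf; rewrite -(avg_absorb (s' := iota n (N - n))); last first.
  by move=> k; rewrite !mem_iota => /andP[_]; rewrite subnKC.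
apply: eq_avg => y; apply: avg_mull => k; rewrite mem_iota => /andP[nk _].
exact: level_coord_inv lf.
Qed.

Lemma level_avg_widen n N N' g x : (N <= N')%N -> level N g ->
  avg (iota n (N' - n)) g x = avg (iota n (N - n)) g x.
Proof.
move=> NN' lg; have [nN|Nn] := leqP n N; last first.
  rewrite (eqP (ltnW Nn : (N - n == 0)%N)) /= avg_id// => k; rewrite mem_iota => /andP[nk _].
  by apply: level_coord_inv lg; rewrite (leq_trans (ltnW Nn)).
rewrite (_ : N' - n = (N - n) + (N' - N))%N; last by lia.
rewrite iotaD avg_cat subnKC//; apply: eq_avg => y; apply: avg_id => k.
by rewrite mem_iota => /andP[Nk _]; exact: level_coord_inv lg.
Qed.

End averages.
Arguments avg : simpl never.

Section real_averages.
Variable m : nat -> nat.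
Hypothesis m_ge2 : forall k, (2 <= m k)%N.
Local Notation G := (vilenkin m).
Variable R : realType.
Implicit Types (x y z : G) (k n : nat) (f g : G -> R) (s : seq nat).

Lemma ler_avg s f g x : (forall y, f y <= g y) -> avg s f x <= avg s g x.
Proof.
move=> fg; elim: s x => // k s IH x; rewrite avg_cons /avg1 ler_wpM2l ?invr_ge0//.
exact: ler_sum.
Qed.

Lemma avg_ge0 s f x : (forall y, 0 <= f y) -> 0 <= avg s f x.
Proof. by move=> f0; rewrite -(avg_cst m_ge2 s (0 : R) x); exact: ler_avg. Qed.

Lemma normc_real (a : R) : Normc.normc (a%:C)%C = `|a|.
Proof. by rewrite /= expr0n addr0 sqrtr_sqr. Qed.

Lemma normc_nat k : Normc.normc (k%:R : R[i]) = k%:R.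
Proof. by rewrite -(rmorph_nat (@real_complex R)) normc_real ger0_norm. Qed.

Lemma normc_avg s (g : G -> R[i]) x :
  Normc.normc (avg s g x) <= avg s (fun y => Normc.normc (g y)) x.
Proof.
elim: s x => // k s IH x; rewrite avg_cons /avg1 Normc.normcM.
have -> : Normc.normc ((m k)%:R^-1 : R[i]) = (m k)%:R^-1.
  by rewrite Normc.normcV normc_nat.
rewrite ler_wpM2l ?invr_ge0//.
apply: (@le_trans _ _ (\sum_(a < m k) Normc.normc (avg s g (vadd (vunit m k a) x)))); last exact: ler_sum.
elim/big_ind2 : _ => [|a b c d ab cd|//]; first by rewrite Normc.normc0.
by rewrite (le_trans (le_normcD _ _))// lerD.
Qed.

End real_averages.

(** * The Vilenkin system *)

Section unit_circle.
Variable R : realType.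
Implicit Types a b : R.

Definition expi a : R[i] := Complex (cos a) (sin a).

Lemma expi0 : expi 0 = 1.
Proof. by rewrite /expi cos0 sin0. Qed.

Lemma expiD a b : expi (a + b) = expi a * expi b.
Proof. by rewrite /expi cosD sinD; congr Complex; rewrite addrC. Qed.

Lemma expi_natM a n : expi (a * n%:R) = expi a ^+ n.
Proof.
elim: n => [|n IH]; first by rewrite mulr0 expi0.
by rewrite -natr1 mulrDr mulr1 expiD IH exprSr.
Qed.

Lemma expi_2pi : expi (2 * pi) = 1.
Proof. by rewrite /expi mulr_natl cos2pi sin2pi. Qed.

Lemma normc_expi a : Normc.normc (expi a) = 1.
Proof. by rewrite /= cos2Dsin2 sqrtr1. Qed.

Lemma expi_neq1 a : 0 < a < 2 * pi -> expi a != 1.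
Proof.
move=> /andP[a0 a2pi]; apply/eqP => /(congr1 (@complex.Re R)) /= cosa.
(* Half-angle argument: [cos a = 1] forces [sin (a / 2) = 0], although [a / 2] lies strictly between
   0 and [pi]. *)
have : 0 < sin (a / 2) by rewrite sin_gt0_pi// divr_gt0//= ltr_pdivrMr// mulrC.
suff -> : sin (a / 2) = 0 by rewrite ltxx.
apply/eqP; rewrite -sqrf_eq0.
have := cos2Dsin2 (a / 2).
have := cosD (a / 2) (a / 2); rewrite -splitr cosa => h1 h2.
by apply/eqP; nra.
Qed.

Lemma conjc_unit (z : R[i]) : Normc.normc z = 1 -> z * conjc z = 1.
Proof.
case: z => a b /= h; have h2 : a ^+ 2 + b ^+ 2 = 1.
  by rewrite -[LHS]sqr_sqrtr ?h ?expr1n// addr_ge0 ?sqr_ge0.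
by apply/eqP; rewrite eq_complex /=; apply/andP; split; apply/eqP; [rewrite -h2|]; ring.
Qed.

Lemma normc_conj (z : R[i]) : Normc.normc (conjc z) = Normc.normc z.
Proof. by case: z => a b /=; rewrite sqrrN. Qed.

Lemma normc_sum (I : Type) (r : seq I) (P : pred I) (F : I -> R[i]) :
  Normc.normc (\sum_(i <- r | P i) F i) <= \sum_(i <- r | P i) Normc.normc (F i).
Proof.
elim/big_ind2 : _ => [|x y z w xy zw|//]; first by rewrite Normc.normc0.
by rewrite (le_trans (le_normcD _ _))// lerD.
Qed.

Lemma normcX (z : R[i]) n : Normc.normc (z ^+ n) = Normc.normc z ^+ n.
Proof.
elim: n => [|n IH]; first by rewrite !expr0 Normc.normc1.
by rewrite !exprS Normc.normcM IH.
Qed.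

Lemma normc_ge0 (z : R[i]) : 0 <= Normc.normc z.
Proof. by case: z => a b; exact: sqrtr_ge0. Qed.

End unit_circle.

(** * Digits in the mixed radix system *)

Section digits.
Variable m : nat -> nat.
Hypothesis m_ge2 : forall k, (2 <= m k)%N.

Lemma vbaseS n : vbase m n.+1 = (vbase m n * m n)%N.
Proof. by rewrite /vbase big_ord_recr. Qed.

Lemma vbase0 : vbase m 0 = 1%N.
Proof. by rewrite /vbase big_ord0. Qed.

Lemma vbase_gt0 n : (0 < vbase m n)%N.
Proof. exact: leq_ltn_trans (vbase_gt m_ge2 n). Qed.

Lemma vbase_double n : (2 * vbase m n <= vbase m n.+1)%N.
Proof. by rewrite vbaseS mulnC leq_mul2l m_ge2 orbT. Qed.

Lemma leq_vbase : {homo vbase m : a b / (a <= b)%N}.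
Proof.
apply: homo_leq => [//|b a c|n]; first exact: leq_trans.
exact: leq_trans (leq_pmull _ _) (vbase_double n).
Qed.

Lemma vdigit_small n N k : (n < vbase m N)%N -> (N <= k)%N -> vdigit m n k = 0%N.
Proof.
by move=> nN Nk; rewrite /vdigit divn_small ?mod0n// (leq_trans nN)// leq_vbase.
Qed.

Lemma block_lt n s N : (n < vbase m N)%N -> (s < m N)%N ->
  (s * vbase m N + n < vbase m N.+1)%N.
Proof.
move=> nN sN; rewrite vbaseS; apply: (@leq_trans (s.+1 * vbase m N)%N).
  by rewrite mulSn addnC ltn_add2r.
by rewrite mulnC leq_mul2l sN orbT.
Qed.

Lemma vdigit_block n s N k : (n < vbase m N)%N -> (s < m N)%N ->
  vdigit m (s * vbase m N + n) k = if (k < N)%N then vdigit m n k else if k == N then s else 0%N.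
Proof.
move=> nN sN; case: ltngtP => [kN|Nk|->].
(* [vbase m N] is a multiple of [vbase m k.+1], so its multiples do not affect the digit of index
   [k]. *)
- have [d ->] : exists d, vbase m N = (d * m k * vbase m k)%N.
    exists (\prod_(k.+1 <= i < N) m i)%N.
    rewrite -mulnA (mulnC (m k)) -vbaseS /vbase -!(big_mkord xpredT m) mulnC.
    by rewrite -big_cat_nat.
  by rewrite /vdigit mulnA divnMDl ?vbase_gt0// mulnA modnMDl.
- apply: (@vdigit_small _ N.+1) => //; exact: block_lt.
- by rewrite /vdigit divnMDl ?vbase_gt0// (divn_small nN) addn0 modn_small.
Qed.

Lemma vdigit_neq0 i a N : (vbase m a <= i < vbase m N)%N ->
  exists2 k, (a <= k < N)%N & vdigit m i k != 0%N.
Proof.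
elim: N => [|N IH] /andP[ai iN]; first by move: (leq_trans iN (leq_vbase (leq0n a))); rewrite ltnNge ai.
have [iN'|iN'] := ltnP i (vbase m N).
  by have [|k /andP[ak kN] ik] := IH; [rewrite ai|exists k; rewrite // ak ltnS ltnW].
exists N.
  by rewrite ltnSn andbT leqNgt; apply/negP => /leq_vbase; rewrite leqNgt (leq_ltn_trans ai iN).
rewrite /vdigit modn_small; last by rewrite ltn_divLR ?vbase_gt0// mulnC -vbaseS.
by rewrite -lt0n divn_gt0 ?vbase_gt0.
Qed.

Lemma vdigit_inj i j : (forall k, vdigit m i k = vdigit m j k) -> i = j.
Proof.
have widen n N : (n <= N)%N -> n = (\sum_(k < N) vdigit m n k * vbase m k)%N.
  move=> nN; rewrite {1}(vdigit_sum m_ge2 n) -!(big_mkord xpredT (fun k => vdigit m n k * vbase m k)%N).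
  rewrite (big_cat_nat _ nN)//= [X in (_ = _ + X)%N]big1_seq ?addn0// => k /=.
  by rewrite mem_index_iota => /andP[nk _]; rewrite (vdigit_eq0 m_ge2).
move=> ij; transitivity (\sum_(k < maxn i j) vdigit m i k * vbase m k)%N.
  by apply: widen; rewrite leq_maxl.
rewrite [RHS](widen j (maxn i j)) ?leq_maxr//.
by apply: eq_bigr => k _; rewrite ij.
Qed.

End digits.

(** * Characters and their orthogonality *)

Section vilenkin_system.
Variable R : realType.
Variable m : nat -> nat.
Hypothesis m_ge2 : forall k, (2 <= m k)%N.
Local Notation G := (vilenkin m).
Local Notation C := R[i].
Implicit Types (x y : G) (k n N : nat).

Definition vroot k : C := expi (2 * pi / (m k)%:R).

Lemma rademacherE k x : rademacher k x = vroot k ^+ (vcoord x k).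
Proof.
by rewrite /rademacher /vroot -expi_natM /expi; congr Complex; congr (_ _); rewrite mulrAC.
Qed.

Let mk_gt0 k : 0 < (m k)%:R :> R.
Proof. by rewrite ltr0n (leq_trans _ (m_ge2 k)). Qed.

Lemma vroot_period k : vroot k ^+ m k = 1.
Proof. by rewrite /vroot -expi_natM divfK ?expi_2pi// gt_eqF. Qed.

Lemma vrootX_neq1 k d : (0 < d < m k)%N -> vroot k ^+ d != 1.
Proof.
move=> /andP[d0 dm]; rewrite /vroot -expi_natM expi_neq1//.
have p0 : 0 < 2 * pi :> R by rewrite mulr_gt0// pi_gt0.
apply/andP; split; first by apply: mulr_gt0; rewrite ?ltr0n// divr_gt0.
by rewrite mulrAC ltr_pdivrMr// ltr_pM2l// ltr_nat.
Qed.

Lemma normc_vroot k : Normc.normc (vroot k) = 1.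
Proof. exact: normc_expi. Qed.

Lemma normc_rademacher k x : Normc.normc (rademacher k x : C) = 1.
Proof. by rewrite rademacherE normcX normc_vroot expr1n. Qed.

Lemma rademacherD k x y : rademacher k (vadd x y) = rademacher k x * rademacher k y :> C.
Proof.
rewrite !rademacherE vcoord_vadd -exprD.
have -> : (vcoord x k + vcoord y k)%R = ((vcoord x k + vcoord y k) %% m k)%N :> nat.
  by rewrite /=; congr (_ %% _)%N; exact: Zp_cast.
exact: expr_mod (vroot_period k).
Qed.

Lemma vcoord_lt k x : (vcoord x k < m k)%N.
Proof. by apply: (leq_trans (ltn_ord _)); rewrite (Zp_cast (m_ge2 k)). Qed.

Lemma rademacher_neq1 k x : vcoord x k != 0 -> rademacher k x != 1 :> C.
Proof.
move=> xk; rewrite rademacherE vrootX_neq1// vcoord_lt andbT lt0n.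
by apply: contra xk => /eqP xk0; apply/eqP/val_inj.
Qed.

Lemma rademacher_period k x : rademacher k x ^+ m k = 1 :> C.
Proof. by rewrite rademacherE exprAC vroot_period expr1n. Qed.

Lemma rademacher0 k x : vcoord x k = 0 -> rademacher k x = 1 :> C.
Proof. by move=> xk; rewrite rademacherE xk. Qed.

Lemma vilenkin_fun_widen n N x : (n < vbase m N)%N ->
  vilenkin_fun n x = \prod_(k < N) rademacher k x ^+ vdigit m n k :> C.
Proof.
move=> nN; rewrite /vilenkin_fun.
pose F k := rademacher k x ^+ vdigit m n k : C.
suff widen a : (forall k, (a <= k)%N -> vdigit m n k = 0%N) ->
    \prod_(k < a) F k = \prod_(k < maxn n N) F k.
  rewrite (widen n); last by move=> k; exact: (vdigit_eq0 m_ge2).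
  by rewrite (widen N)// => k; exact: vdigit_small nN.
have split c b : (c <= b)%N -> (forall k, (c <= k)%N -> vdigit m n k = 0%N) ->
    \prod_(k < c) F k = \prod_(k < b) F k.
  move=> cb c0; rewrite -!(big_mkord xpredT F) (big_cat_nat _ cb)//=.
  rewrite [X in _ = _ * X]big1_seq ?mulr1// => k /=.
  by rewrite mem_index_iota => /andP[ck _]; rewrite /F c0.
move=> a0; rewrite (split a (maxn a (maxn n N)))// ?leq_maxl//.
rewrite (split (maxn n N) (maxn a (maxn n N)))// ?leq_maxr// => k nk.
by apply: (vdigit_small m_ge2 nN); rewrite (leq_trans _ nk) ?leq_maxr.
Qed.

Lemma level_vilenkin_fun n N : (n < vbase m N)%N -> level N (@vilenkin_fun R m n).
Proof.
move=> nN x y xy; rewrite !(vilenkin_fun_widen _ nN); apply: eq_bigr => k _.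
by rewrite !rademacherE xy.
Qed.

Lemma vilenkin_funD n x y : vilenkin_fun n (vadd x y) = vilenkin_fun n x * vilenkin_fun n y :> C.
Proof. by rewrite /vilenkin_fun -big_split; apply: eq_bigr => k _; rewrite rademacherD exprMn. Qed.

Lemma normc_vilenkin_fun n x : Normc.normc (vilenkin_fun n x : C) = 1.
Proof.
rewrite /vilenkin_fun; elim/big_ind : _ => [|a b a1 b1|k _]; first exact: Normc.normc1.
  by rewrite Normc.normcM a1 b1 mulr1.
by rewrite normcX normc_rademacher expr1n.
Qed.

Lemma vilenkin_fun_block n s N x : (n < vbase m N)%N -> (s < m N)%N ->
  vilenkin_fun (s * vbase m N + n) x = rademacher N x ^+ s * vilenkin_fun n x :> C.
Proof.
move=> nN sN; rewrite (@vilenkin_fun_widen _ N.+1); last exact: block_lt.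
rewrite big_ord_recr /= (vdigit_block m_ge2 _ nN sN) ltnn eqxx mulrC; congr (_ * _).
rewrite (vilenkin_fun_widen _ nN); apply: eq_bigr => k _.
by rewrite (vdigit_block m_ge2 _ nN sN) ltn_ord.
Qed.

Lemma rademacher_vunit q k : rademacher q (vunit m k 1) = if q == k then vroot k else 1 :> C.
Proof.
rewrite rademacherE /vcoord /vunit; case: eqP => [->|//].
by rewrite val_Zp_nat ?m_ge2// modn_small ?expr1.
Qed.

Lemma vilenkin_fun_vunit n k x :
  vilenkin_fun n (vadd (vunit m k 1) x) = vroot k ^+ vdigit m n k * vilenkin_fun n x :> C.
Proof.
rewrite vilenkin_funD; congr (_ * _).
have nN : (n < vbase m (maxn n k.+1))%N.
  by rewrite (leq_trans (vbase_gt m_ge2 n))// leq_vbase// leq_maxl.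
rewrite (vilenkin_fun_widen _ nN).
have kN : (k < maxn n k.+1)%N by rewrite leq_maxr.
rewrite (bigD1 (Ordinal kN))//= rademacher_vunit eqxx big1 ?mulr1// => q qk.
by rewrite rademacher_vunit ifN ?expr1n.
Qed.

Lemma vrootX_inj k d e : (d < m k)%N -> (e < m k)%N -> vroot k ^+ d = vroot k ^+ e -> d = e.
Proof.
wlog de : d e / (d <= e)%N.
  by move=> H dm em de; case: (leqP d e) => [|/ltnW] ?; [exact: H|apply/esym/H].
move=> dm em; rewrite -(subnKC de) exprD => /eqP.
have root0 : vroot k ^+ d != 0.
  apply/eqP => /(congr1 (@Normc.normc R)); rewrite normcX normc_vroot expr1n Normc.normc0.
  by move/eqP; rewrite oner_eq0.
rewrite -{1}[vroot k ^+ d]mulr1 (inj_eq (mulfI root0)) eq_sym.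
case: (posnP (e - d)) => [-> _|ed0]; first by rewrite addn0.
by rewrite (negbTE (vrootX_neq1 _))// ed0 (leq_ltn_trans (leq_subr _ _)).
Qed.

Lemma avg_vilenkin_fun_eq0 i a N x : (vbase m a <= i < vbase m N)%N ->
  avg (iota a (N - a)) (@vilenkin_fun R m i) x = 0.
Proof.
move=> iaN; have [k /andP[ak kN] ik] := vdigit_neq0 m_ge2 iaN.
apply: (@avg_eq0 _ m_ge2 _ _ k (vroot k ^+ vdigit m i k)).
- by rewrite mem_iota ak subnKC// (leq_trans ak (ltnW kN)).
- by rewrite vrootX_neq1// lt0n ik vdigit_lt.
- by move=> y; rewrite vilenkin_fun_vunit.
Qed.

(** Distinct indices differ in some digit [k]; a shift of coordinate [k] then multiplies the product
    by a quotient of two distinct [m k]-th roots of unity. *)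
Lemma vilenkin_fun_orthonormal i j N x : (i < vbase m N)%N -> (j < vbase m N)%N ->
  avg (iota 0 N) (fun y => vilenkin_fun i y * conjc (vilenkin_fun j y)) x = (i == j)%:R :> C.
Proof.
move=> iN jN; have [<-|ij] := eqVneq i j.
  rewrite -[RHS](avg_cst m_ge2 (iota 0 N) (1 : C) x); apply: eq_avg => y.
  by rewrite conjc_unit// normc_vilenkin_fun.
have /existsNP[k /eqP ijk] : ~ forall k, vdigit m i k = vdigit m j k.
  by move/(vdigit_inj m_ge2)/eqP; rewrite (negbTE ij).
apply: (@avg_eq0 _ m_ge2 _ _ k (vroot k ^+ vdigit m i k * conjc (vroot k ^+ vdigit m j k))).
- rewrite mem_iota /= add0n ltnNge; apply/negP => Nk.
  by move: ijk; rewrite !(@vdigit_small _ m_ge2 _ N).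
- apply: contra ijk => /eqP h; apply/eqP/(@vrootX_inj k); rewrite ?vdigit_lt//.
  have u : Normc.normc (vroot k ^+ vdigit m j k) = 1 by rewrite normcX normc_vroot expr1n.
  have := congr1 (fun z => z * vroot k ^+ vdigit m j k) h.
  by rewrite -mulrA [conjc _ * _]mulrC conjc_unit// mulr1 mul1r.
- move=> y; rewrite !vilenkin_fun_vunit rmorphM /=; ring.
Qed.

End vilenkin_system.

(** * Fejer kernels *)

Section kernels.
Variable R : realType.
Variable m : nat -> nat.
Hypothesis m_ge2 : forall k, (2 <= m k)%N.
Local Notation G := (vilenkin m).
Local Notation C := R[i].
Local Notation M i := ((vbase m i)%:R : R).
Local Notation "`| z |c" := (Normc.normc z) (format "`| z |c").
Implicit Types (x y t : G) (i k n h N : nat).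

Definition dirichlet n x : C := \sum_(i < n) vilenkin_fun i x.

(* Since [S_0 = 0], this is [n - 1] times the Fejer kernel of order [n - 1]. *)
Definition fejer_sum n x : C := \sum_(k < n) dirichlet k x.

(* The coordinates of [x] below [i] vanish, except possibly the one of index [h]:
   the kernels concentrate on these sets. *)
Definition zeros i h x : bool := [forall q : 'I_i, (q == h :> nat) || (vcoord x q == 0)].

(** Up to a constant, [M i * M h] is the size of the Fejer sum of order [vbase m i] at points whose
    only nonzero coordinate below [i] is [h], and [majY] is its peak, where all these coordinates
    vanish. *)
Definition majW i x : R := \sum_(h < i) M i * M h * (zeros i h x)%:R.
Definition majY i x : R := M i ^+ 2 * (zeros i i x)%:R.
Definition majX i x : R := majW i x + majY i x.
Definition majU n x : R := \sum_(i < n.+1) majX i x.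

Lemma vbase_real_gt0 i : 0 < M i.
Proof. by rewrite ltr0n vbase_gt0. Qed.
Local Hint Resolve vbase_real_gt0 : core.

Lemma vbase_realS i : M i.+1 = M i * (m i)%:R.
Proof. by rewrite vbaseS natrM. Qed.

Lemma vbase_real_double i : 2 * M i <= M i.+1.
Proof. by rewrite -natrM ler_nat vbase_double. Qed.

Lemma level_zeros i h : level i (zeros i h).
Proof. by move=> x y xy; apply: eq_forallb => q; rewrite xy. Qed.

Lemma zerosS_lt i h x : (h < i)%N -> zeros i.+1 h x = zeros i h x && (vcoord x i == 0).
Proof.
move=> hi; apply/forallP/andP => [z|[/forallP z xi] q].
  split; last by have := z ord_max; rewrite /= gtn_eqF//.
  by apply/forallP => q; have := z (widen_ord (leqnSn i) q).
have [qi|] := ltnP q i; first exact: (z (Ordinal qi)).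
move=> iq; have -> : q = ord_max by apply/val_inj/eqP; rewrite /= eqn_leq iq -ltnS ltn_ord.
by rewrite xi orbT.
Qed.

Lemma zerosS_eq i x : zeros i.+1 i x = zeros i i x.
Proof.
apply/forallP/forallP => z q; first exact: (z (widen_ord (leqnSn i) q)).
have [qi|] := ltnP q i; first exact: (z (Ordinal qi)).
by move=> iq; rewrite (_ : (q == i :> nat)) // eqn_leq iq -ltnS ltn_ord.
Qed.

Lemma zerosSS i x : zeros i.+1 i.+1 x = zeros i i x && (vcoord x i == 0).
Proof.
apply/forallP/andP => [z|[/forallP z xi] q].
  split; last by have := z ord_max; rewrite /= ltn_eqF//.
  by apply/forallP => q; have := z (widen_ord (leqnSn i) q); rewrite /= !ltn_eqF// ltnS ltnW.
have [qi|] := ltnP q i; first by have := z (Ordinal qi); rewrite /= !ltn_eqF// ltnS ltnW.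
move=> iq; have -> : q = ord_max by apply/val_inj/eqP; rewrite /= eqn_leq iq -ltnS ltn_ord.
by rewrite xi orbT.
Qed.

Lemma majW_ge0 i x : 0 <= majW i x.
Proof. by apply: sumr_ge0 => h _; rewrite !mulr_ge0. Qed.

Lemma majY_ge0 i x : 0 <= majY i x.
Proof. by rewrite mulr_ge0 ?sqr_ge0. Qed.

Lemma majX_ge0 i x : 0 <= majX i x.
Proof. by rewrite addr_ge0 ?majW_ge0 ?majY_ge0. Qed.

(** The recursion mirrors [fejer_sum_muln] at [s = m i]: the previous sum survives only where the
    new coordinate vanishes, and the peak feeds the new index [h = i]. *)
Lemma majWS i x :
  majW i.+1 x = (m i)%:R * (vcoord x i == 0)%:R * majW i x + (m i)%:R * majY i x.
Proof.
rewrite /majW big_ord_recr /= zerosS_eq; congr (_ + _).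
  rewrite mulr_sumr; apply: eq_bigr => h _.
  by rewrite zerosS_lt// -mulnb natrM vbase_realS; ring.
by rewrite /majY vbase_realS; ring.
Qed.

Lemma majYS i x : majY i.+1 x = (m i)%:R ^+ 2 * (vcoord x i == 0)%:R * majY i x.
Proof. by rewrite /majY zerosSS -mulnb natrM vbase_realS; ring. Qed.

Lemma level_majW i : level i (majW i).
Proof. by move=> x y xy; apply: eq_bigr => h _; rewrite (level_zeros _ xy). Qed.

Lemma level_majY i : level i (majY i).
Proof. by move=> x y xy; rewrite /majY (level_zeros _ xy). Qed.

Lemma level_majX i : level i (majX i).
Proof. by move=> x y xy; rewrite /majX (level_majW xy) (level_majY xy). Qed.

Lemma level_majU n : level n (majU n).
Proof.
by move=> x y xy; apply: eq_bigr => i _; apply: (level_le _ (@level_majX i)) xy; rewrite -ltnS.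
Qed.

Lemma majX_le_majU n x : majX n x <= majU n x.
Proof. by rewrite /majU big_ord_recr /= lerDr sumr_ge0// => i _; exact: majX_ge0. Qed.

Lemma majU_ge0 n x : 0 <= majU n x.
Proof. by apply: sumr_ge0 => i _; exact: majX_ge0. Qed.

Lemma avg1_coord0 k x : avg1 k (fun y => (vcoord y k == 0)%:R) x = (m k)%:R^-1 :> R.
Proof.
rewrite /avg1 -[RHS]mulr1; congr (_ * _).
have zlt (z : 'Z_(m k)) : (z < m k)%N by apply: (leq_trans (ltn_ord z)); rewrite Zp_cast.
have [z zE] : exists z, z + vcoord x k = 0 by exists (- vcoord x k); rewrite addNr.
rewrite (bigD1 (Ordinal (zlt z)))//= big1 ?addr0 => [|a].
  by rewrite vcoord_vunit eqxx natr_Zp zE eqxx.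
rewrite -val_eqE /= => aE; rewrite vcoord_vunit eqxx -zE (inj_eq (addIr _)).
case: eqP => // az; case/negP: aE; apply/eqP.
by rewrite -[LHS](@modn_small _ (m k))// -val_Zp_nat// az.
Qed.

Lemma level_dirichlet n N : (n <= vbase m N)%N -> level N (dirichlet n).
Proof.
move=> nN; apply: level_sum => i _; apply: level_vilenkin_fun => //.
exact: leq_trans (ltn_ord i) nN.
Qed.

Lemma level_fejer_sum n N : (n <= vbase m N)%N -> level N (fejer_sum n).
Proof.
move=> nN; apply: level_sum => i _; apply: level_dirichlet.
exact: leq_trans (ltnW (ltn_ord i)) nN.
Qed.

Lemma dirichlet_block N s n x : (n <= vbase m N)%N -> (s < m N)%N ->
  dirichlet (s * vbase m N + n) x =
  dirichlet (s * vbase m N) x + rademacher N x ^+ s * dirichlet n x.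
Proof.
move=> nN sN; rewrite /dirichlet big_split_ord /=; congr (_ + _).
rewrite mulr_sumr; apply: eq_bigr => i _.
by rewrite vilenkin_fun_block// (leq_trans (ltn_ord i)).
Qed.

Lemma dirichlet_muln N s x : (s <= m N)%N ->
  dirichlet (s * vbase m N) x =
  (\sum_(a < s) rademacher N x ^+ a) * dirichlet (vbase m N) x.
Proof.
elim: s => [|s IH] sN; first by rewrite mul0n /dirichlet !big_ord0 mul0r.
by rewrite mulSnr dirichlet_block// IH 1?ltnW// big_ord_recr mulrDl.
Qed.

Lemma sum_rademacher N x :
  \sum_(a < m N) rademacher N x ^+ a = (m N)%:R * (vcoord x N == 0)%:R :> C.
Proof.
case: eqP => [xN|/eqP xN].
  rewrite mulr1 (eq_bigr (fun=> 1)) ?sumr_const ?card_ord// => i _.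
  by rewrite rademacher0// expr1n.
rewrite mulr0; have := subrX1 (rademacher N x : C) (m N).
rewrite rademacher_period// subrr => /esym/eqP.
by rewrite mulf_eq0 subr_eq0 (negbTE (rademacher_neq1 _ m_ge2 xN)) => /eqP.
Qed.

(** Paley's formula. Each order multiplies the kernel by a full geometric sum of [m N]-th roots of
    unity, which is [m N] or 0. *)
Lemma dirichlet_vbase N x : dirichlet (vbase m N) x = (vbase m N)%:R * (zeros N N x)%:R.
Proof.
elim: N => [|N IH].
  rewrite vbase0 /dirichlet big_ord1 /vilenkin_fun big_ord0 mul1r.
  by rewrite (_ : zeros 0 0 x)//; apply/forallP => -[].
rewrite vbaseS mulnC dirichlet_muln// sum_rademacher IH zerosSS -mulnb !natrM; ring.
Qed.

Lemma fejer_sum_block N s n x : (n <= vbase m N)%N -> (s < m N)%N ->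
  fejer_sum (s * vbase m N + n) x =
  fejer_sum (s * vbase m N) x + n%:R * dirichlet (s * vbase m N) x
  + rademacher N x ^+ s * fejer_sum n x.
Proof.
move=> nN sN; rewrite /fejer_sum big_split_ord /= -addrA; congr (_ + _).
rewrite (eq_bigr (fun i : 'I_n => dirichlet (s * vbase m N) x + rademacher N x ^+ s * dirichlet i x)).
  by rewrite big_split /= sumr_const card_ord mulr_natl mulr_sumr.
by move=> i _; rewrite dirichlet_block// (leq_trans (ltnW (ltn_ord i))).
Qed.

Lemma fejer_sum_muln N s x : (s <= m N)%N ->
  fejer_sum (s * vbase m N) x =
  (vbase m N)%:R * (\sum_(a < s) dirichlet (a * vbase m N) x)
  + (\sum_(a < s) rademacher N x ^+ a) * fejer_sum (vbase m N) x.
Proof.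
elim: s => [|s IH] sN; first by rewrite mul0n /fejer_sum !big_ord0 mul0r mulr0 addr0.
by rewrite mulSnr fejer_sum_block// IH 1?ltnW// !big_ord_recr /=; ring.
Qed.

Lemma normc_dirichlet_muln N s x : (s <= m N)%N ->
  M N * `|dirichlet (s * vbase m N) x|c <= s%:R * majY N x.
Proof.
move=> sN; rewrite dirichlet_muln// Normc.normcM dirichlet_vbase Normc.normcM !normc_nat.
rewrite (_ : s%:R * majY N x = M N * (s%:R * (M N * (zeros N N x)%:R))); last by rewrite /majY; ring.
rewrite ler_wpM2l// ler_wpM2r ?mulr_ge0//.
apply: le_trans (normc_sum _ _ _) _.
rewrite (eq_bigr (fun=> 1)) ?sumr_const ?card_ord// => a _.
by rewrite normcX normc_rademacher expr1n.
Qed.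

Lemma normc_fejer_sum_muln N s x : (s <= m N)%N ->
  `|fejer_sum (s * vbase m N) x|c <=
  s%:R ^+ 2 * majY N x +
  `|(\sum_(a < s) rademacher N x ^+ a)|c * `|fejer_sum (vbase m N) x|c.
Proof.
move=> sN; rewrite fejer_sum_muln//; apply: le_trans (le_normcD _ _) _.
rewrite !Normc.normcM lerD2r normc_nat.
apply: (@le_trans _ _ (\sum_(a < s) M N * `|dirichlet (a * vbase m N) x|c)).
  by rewrite -mulr_sumr ler_wpM2l// normc_sum.
rewrite expr2 -mulrA -[leRHS](_ : \sum_(a < s) (s%:R * majY N x) = _); last first.
  by rewrite sumr_const card_ord -[LHS]mulr_natl.
apply: ler_sum => a _; apply: le_trans (normc_dirichlet_muln _ _) _.
  exact: leq_trans (ltnW (ltn_ord a)) sN.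
by rewrite ler_wpM2r ?majY_ge0// ler_nat ltnW.
Qed.

Variable B : nat.
Hypothesis m_le : forall k, (m k <= B)%N.
Local Notation b := (B%:R : R).

Let m_ler k : (m k)%:R <= b.
Proof. by rewrite ler_nat. Qed.

Let m_ge1 k : 1 <= (m k)%:R :> R.
Proof. by rewrite ler1n (leq_trans _ (m_ge2 k)). Qed.

Lemma normc_fejer_sum_vbase i x : `|fejer_sum (vbase m i) x|c <= b ^+ 2 * majX i x.
Proof.
elim: i => [|i IH].
  rewrite vbase0 /fejer_sum big_ord1 /dirichlet big_ord0 Normc.normc0.
  by rewrite mulr_ge0 ?majX_ge0 ?sqr_ge0.
rewrite vbaseS mulnC; apply: le_trans (normc_fejer_sum_muln _ _) _ => //.
rewrite sum_rademacher Normc.normcM !normc_nat /majX majWS majYS.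
have := majW_ge0 i x; have := majY_ge0 i x; have := m_ler i; have := m_ge1 i.
move: IH; rewrite /majX; set L := `|_|c; set W := majW i x; set Y := majY i x.
set c := (m i)%:R; move=> IH c1 cb Y0 W0.
have b1 : 1 <= b by exact: le_trans cb.
case: eqP => _; rewrite ?mulr1 ?mulr0 ?mul0r ?addr0 ?add0r.
  have h1 : c * L <= c * (b ^+ 2 * (W + Y)) by rewrite ler_wpM2l// (le_trans _ c1).
  apply: le_trans (lerD (lexx _) h1) _.
  rewrite -subr_ge0 [X in 0 <= X](_ : _ = c * (b ^+ 2 - c) * Y + b ^+ 2 * c * (c - 1) * Y); last by ring.
  by rewrite addr_ge0 ?mulr_ge0 ?sqr_ge0 ?subr_ge0//; nra.
rewrite mulrA ler_wpM2r// expr2; nra.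
Qed.

(** Splitting off the leading digit of [n] leaves three terms of order [N], each at most
    [b ^+ 3 * majX N x], and a Fejer sum of smaller order to which the induction applies. *)
Lemma normc_fejer_sum N n x : (n < vbase m N)%N ->
  `|fejer_sum n x|c <= 3 * b ^+ 3 * \sum_(i < N) majX i x.
Proof.
elim: N n => [|N IH] n nN.
  move: nN; rewrite vbase0 ltnS leqn0 => /eqP ->.
  by rewrite /fejer_sum big_ord0 Normc.normc0 big_ord0 mulr0.
rewrite (divn_eq n (vbase m N)); set s := (n %/ _)%N; set n' := (n %% _)%N.
have n'N : (n' < vbase m N)%N by rewrite ltn_mod vbase_gt0.
have sN : (s < m N)%N by rewrite ltn_divLR ?vbase_gt0// mulnC -vbaseS.
rewrite (fejer_sum_block _ (ltnW n'N) sN) big_ord_recr /= mulrDr [leRHS]addrC.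
apply: le_trans (le_normcD _ _) _; apply: lerD; last first.
  by rewrite Normc.normcM normcX normc_rademacher expr1n mul1r IH.
apply: le_trans (le_normcD _ _) _; rewrite Normc.normcM normc_nat.
have h1 := normc_fejer_sum_muln x (ltnW sN).
have h2 := normc_fejer_sum_vbase N x.
have h3 : `|(\sum_(a < s) rademacher N x ^+ a)|c <= b.
  apply: le_trans (normc_sum _ _ _) _.
  rewrite (eq_bigr (fun=> 1)) => [|a _]; last by rewrite normcX normc_rademacher expr1n.
  by rewrite sumr_const card_ord ler_nat (leq_trans (ltnW sN)).
have h4 : n'%:R * `|dirichlet (s * vbase m N) x|c <= b * majY N x.
  apply: le_trans (le_trans (normc_dirichlet_muln x (ltnW sN)) _).
    by rewrite ler_wpM2r ?normc_ge0// ler_nat ltnW.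
  by rewrite ler_wpM2r ?majY_ge0// ler_nat (leq_trans (ltnW sN)).
have h5 : s%:R ^+ 2 * majY N x <= b ^+ 2 * majY N x.
  by rewrite ler_wpM2r ?majY_ge0// lerXn2r ?nnegrE// ler_nat (leq_trans (ltnW sN)).
have h6 : `|(\sum_(a < s) rademacher N x ^+ a)|c * `|fejer_sum (vbase m N) x|c <=
    b * (b ^+ 2 * majX N x) by rewrite ler_pM ?normc_ge0.
have b1 : 1 <= b by exact: le_trans (m_ler N).
have YX : majY N x <= majX N x by rewrite lerDr majW_ge0.
have Y0 := majY_ge0 N x.
have e2 : b ^+ 2 * majY N x <= b ^+ 3 * majX N x.
  by rewrite ler_pM ?sqr_ge0// [leRHS]exprS ler_peMl ?sqr_ge0.
have e1 : b * majY N x <= b ^+ 3 * majX N x.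
  by rewrite ler_pM// [leRHS]exprS ler_peMr// exprn_ege1.
have e3 : b * (b ^+ 2 * majX N x) = b ^+ 3 * majX N x by ring.
lra.
Qed.

(** The factor [m i] on a zero coordinate averages to 1, so the conditional expectation reproduces
    [majW] and only adds the peak. *)
Lemma avg1_majWS i x : avg1 i (majW i.+1) x = majW i x + (m i)%:R * majY i x.
Proof.
have m0 : (m i)%:R != 0 :> R by rewrite gt_eqF// (lt_le_trans _ (m_ge1 i)).
rewrite -avg_seq1 (eq_avg _ (majWS i)) avgD avgZ; congr (_ + _).
  transitivity (avg [:: i] (fun y => (m i)%:R * (majW i y * (vcoord y i == 0)%:R)) x).
    by apply: eq_avg => y; ring.
  rewrite avgZ avg_mull => [|q]; last first.
    by rewrite inE => /eqP ->; apply: level_coord_inv (@level_majW i).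
  by rewrite avg_seq1 avg1_coord0; field.
by rewrite avg_id// => q; rewrite inE => /eqP ->; apply: level_coord_inv (@level_majY i).
Qed.

Lemma avg1_majYS i x : avg1 i (majY i.+1) x = (m i)%:R * majY i x.
Proof.
have m0 : (m i)%:R != 0 :> R by rewrite gt_eqF// (lt_le_trans _ (m_ge1 i)).
rewrite -avg_seq1 (eq_avg _ (majYS i)).
transitivity (avg [:: i] (fun y => (m i)%:R ^+ 2 * (majY i y * (vcoord y i == 0)%:R)) x).
  by apply: eq_avg => y; ring.
rewrite avgZ avg_mull => [|q]; last first.
  by rewrite inE => /eqP ->; apply: level_coord_inv (@level_majY i).
by rewrite avg_seq1 avg1_coord0; field.
Qed.

Lemma avg_majY n d x : avg (iota n d) (majY (n + d)) x = M (n + d) / M n * majY n x.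
Proof.
elim: d => [|d IH] in x *; first by rewrite addn0 divff ?mul1r// gt_eqF.
rewrite addnS -addn1 iotaD avg_cat.
have -> : avg (iota (n + d) 1) (majY (n + d).+1) = (fun y => (m (n + d))%:R * majY (n + d) y).
  by apply/funext => y; exact: avg1_majYS.
by rewrite avgZ IH vbase_realS; ring.
Qed.

(** Each order adds [2 * c - 1] times the conditional mean of the peak, where [c >= 2] is the next
    term of [m]. The constant 4 closes the induction because [4 + (2 * c - 1) <= 4 * c]. *)
Lemma avg_majX n d x : avg (iota n d) (majX (n + d)) x <=
  majX n x + 4 * (M (n + d) / M n) * majY n x.
Proof.
elim: d => [|d IH] in x *.
  by rewrite addn0 lerDl mulr_ge0 ?majY_ge0// mulr_ge0// divr_ge0.
rewrite addnS -addn1 iotaD avg_cat.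
have -> : avg (iota (n + d) 1) (majX (n + d).+1) =
    (fun y => majX (n + d) y + (2 * (m (n + d))%:R - 1) * majY (n + d) y).
  apply/funext => y; rewrite -[LHS]/(avg [:: (n + d)%N] (fun z => majW (n + d).+1 z + majY (n + d).+1 z) y).
  rewrite avgD !avg_seq1 avg1_majWS avg1_majYS /majX; ring.
rewrite avgD avgZ avg_majY; apply: le_trans (lerD (IH x) (lexx _)) _.
rewrite -addrA lerD2l [in leRHS]vbase_realS.
have c2 : 2 <= (m (n + d))%:R :> R by rewrite ler_nat.
have : 0 <= M (n + d)%N / M n * majY n x by rewrite mulr_ge0 ?majY_ge0// divr_ge0.
move: c2; rewrite -!mulrA.
set c := (m _)%:R; rewrite -subr_ge0 => c2 zY.
rewrite -subr_ge0 [X in 0 <= X](_ : _ = (2 * (c - 2) + 1) * (M (n + d)%N * ((M n)^-1 * majY n x))); last by ring.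
by rewrite mulr_ge0// addr_ge0// mulr_ge0.
Qed.

(** Geometric growth makes the last terms dominate. In the induction [10 * M N <= 5 * M N.+1], and
    the new term costs [1 + 4] more by [avg_majX], which gives 10 again. *)
Lemma sum_avg_majX n N K x : (n <= N <= K)%N ->
  \sum_(i < N.+1) avg (iota n (K - n)) (majX i) x <= 10 * (M N / M n) * majU n x.
Proof.
elim: N => [|N IH] /andP[nN NK].
  move: nN; rewrite leqn0 => /eqP ->; rewrite divff ?gt_eqF// mulr1.
  rewrite /majU !big_ord1 (avg_id m_ge2) => [|k _]; first by rewrite ler_peMl ?majX_ge0// ler1n.
  exact: level_coord_inv (@level_majX 0).
have [nE|nN'] := eqVneq n N.+1.
  rewrite -nE divff ?gt_eqF// mulr1 /majU.
  apply: (@le_trans _ _ (majU n x)); last by rewrite ler_peMl ?majU_ge0// ler1n.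
  apply: ler_sum => i _; rewrite avg_id// => k; rewrite mem_iota => /andP[nk _].
  by apply: level_coord_inv (@level_majX i); rewrite (leq_trans _ nk)// -ltnS.
have {}nN : (n <= N)%N by rewrite -ltnS ltn_neqAle nN' nN.
rewrite big_ord_recr /=; apply: le_trans (lerD (IH _) (lexx _)) _; first by rewrite nN ltnW.
rewrite (level_avg_widen m_ge2 _ _ NK (@level_majX N.+1)).
have h1 := avg_majX n (N.+1 - n) x; rewrite subnKC ?(leqW nN)// in h1.
have h2 : majX n x <= M N.+1 / M n * majU n x.
  apply: le_trans (majX_le_majU _ _) _; rewrite ler_peMl ?majU_ge0// ler_pdivlMr// mul1r.
  by rewrite ler_nat leq_vbase// leqW.
have h3 : 4 * (M N.+1 / M n) * majY n x <= 4 * (M N.+1 / M n) * majU n x.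
  rewrite ler_wpM2l ?mulr_ge0 ?divr_ge0//.
  by apply: le_trans (majX_le_majU _ _); rewrite lerDr majW_ge0.
have h4 : 2 * (M N / M n) * majU n x <= M N.+1 / M n * majU n x.
  by rewrite ler_wpM2r ?majU_ge0// mulrA ler_wpM2r ?invr_ge0// vbase_real_double.
lra.
Qed.

Lemma vbase_bracket a N n : (vbase m a <= n < vbase m N)%N ->
  exists2 k, (a <= k < N)%N & (vbase m k <= n < vbase m k.+1)%N.
Proof.
elim: N => [|N IH] /andP[an nN].
  by move: (leq_trans nN (leq_vbase m_ge2 (leq0n a))); rewrite ltnNge an.
have [nN'|Nn] := ltnP n (vbase m N).
  by have [|k /andP[ak kN] ?] := IH; [rewrite an|exists k; rewrite // ak ltnS ltnW].
exists N; last by rewrite Nn.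
rewrite ltnSn andbT leqNgt; apply/negP => /(leq_vbase m_ge2).
by rewrite leqNgt (leq_ltn_trans an nN).
Qed.

Lemma avg_normc_fejer_sum n N K x : (vbase m n <= N < vbase m K)%N ->
  avg (iota n (K - n)) (fun t => `|fejer_sum N t|c) x <=
  30 * b ^+ 3 * (N%:R / M n) * majU n x.
Proof.
move=> /vbase_bracket[k /andP[nk kK] /andP[kN Nk]].
apply: (@le_trans _ _ (avg (iota n (K - n)) (fun t => 3 * b ^+ 3 * \sum_(i < k.+1) majX i t) x)).
  by apply: ler_avg => t; exact: normc_fejer_sum.
rewrite avgZ avg_sum (_ : 30 * b ^+ 3 * (N%:R / M n) * majU n x =
  3 * b ^+ 3 * (10 * (N%:R / M n) * majU n x)); last by ring.
rewrite ler_wpM2l ?mulr_ge0 ?exprn_ge0//.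
apply: le_trans (@sum_avg_majX n k K x _) _; first by rewrite nk ltnW.
rewrite ler_wpM2r ?majU_ge0// ler_wpM2l// ler_wpM2r ?invr_ge0// ler_nat//.
Qed.

End kernels.

(** * Truncation of the kernel majorant *)

Section truncated_kernel.
Variable R : realType.

Lemma min_sum_le (I : Type) (r : seq I) (P : pred I) (F : I -> R) (s : R) :
  0 <= s -> (forall i, P i -> 0 <= F i) ->
  Num.min (\sum_(i <- r | P i) F i) s <= \sum_(i <- r | P i) Num.min (F i) s.
Proof.
move=> s0 F0; pose K (x y : R) := 0 <= x /\ Num.min x s <= y.
suff [] : K (\sum_(i <- r | P i) F i) (\sum_(i <- r | P i) Num.min (F i) s) by [].
apply: big_ind2 => [|x1 y1 x2 y2 [x10 h1] [x20 h2]|i Pi].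
- by split; rewrite // ge_min lexx.
- split; first exact: addr_ge0.
  apply: le_trans (lerD h1 h2).
  by rewrite /Num.min; case: ifPn; case: ifPn; case: ifPn; lra.
- by split; [exact: F0|].
Qed.

(* [3 / 4] is a rational upper bound of the square root of [1 / 2]. *)
Let w (k i : nat) : R := (3 / 4) ^+ ((k - i) + (i - k)).

(** The indices from [k] on contribute at most 4 and those below [k] at most 3; the induction
    carries the exact tail of these geometric series. *)
Lemma sum_two_sided_geometric k n : \sum_(i < n) w k i <= 7.
Proof.
suff : \sum_(i < n) w k i <=
    if (n <= k)%N then 3 * (3 / 4) ^+ (k - n) else 7 - 4 * (3 / 4) ^+ (n - k).
  move=> /le_trans; apply; case: ifP => _; last by rewrite gerBl mulr_ge0// exprn_ge0//; lra.
  have : (3 / 4 : R) ^+ (k - n) <= 1 by rewrite exprn_ile1//; lra.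
  lra.
elim: n => [|n IH].
  by rewrite big_ord0 leq0n mulr_ge0// exprn_ge0//; lra.
rewrite big_ord_recr /= {2}/w; move: IH; case: ltngtP => [nk|kn|->] IH.
- have -> : (n - k = 0)%N by lia.
  rewrite addn0 -(@subnSK n k)// exprS.
  by move: IH; rewrite -(@subnSK n k)// exprS; lra.
- rewrite (_ : (k - n = 0)%N); last by lia.
  by rewrite (_ : (n.+1 - k = (n - k).+1)%N) ?exprS; [lra|lia].
- by move: IH; rewrite subnn subSnn expr1 expr0; lra.
Qed.

(** As [1 / 2 <= (3 / 4) ^ 2], a decay by halves in the larger distance pays for a decay by [3 / 4]
    in both distances. *)
Lemma half_le_w (k h i : nat) : ((k - h) + (h - k) <= (k - i) + (i - k))%N ->
  2^-1 ^+ ((k - i) + (i - k)) <= w k h * w k i.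
Proof.
rewrite /w; set a := (_ + _)%N; set b := (_ + _)%N => ab.
rewrite -exprD; apply: (@le_trans _ _ ((3 / 4) ^+ (b + b))); last first.
  by rewrite ler_wiXn2l ?leq_add2r//; lra.
by rewrite addnn -mul2n exprM lerXn2r ?nnegrE//; lra.
Qed.

Variable m : nat -> nat.
Hypothesis m_ge2 : forall k, (2 <= m k)%N.
Local Notation G := (vilenkin m).
Local Notation M i := ((vbase m i)%:R : R).
Implicit Types (x y t : G) (i k n h N : nat).

Lemma vbase_exp j d : 2 ^+ d * M j <= M (j + d).
Proof.
elim: d => [|d IH]; first by rewrite mul1r addn0.
by rewrite addnS exprS -mulrA; apply: le_trans (vbase_real_double _ m_ge2 _); rewrite ler_pM2l.
Qed.

(* With [k] the index at which [vbase m] crosses [r], the bound decays geometrically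
   in the distance of both [h] and [i] to [k], so that it can be summed over pairs. *)
Lemma min_vbase_le (r : R) k h i : 0 < r -> r <= M k ->
  (forall j, (j < k)%N -> M j < r) -> (h <= i)%N ->
  Num.min (M h) (r ^+ 2 / M i) <= 2 * r * (w k h * w k i).
Proof.
move=> r0 rk klt hi.
have M0 j : 0 < M j by exact: vbase_real_gt0.
have low j : (j < k)%N -> M j <= 2 * r * 2^-1 ^+ ((k - j) + (j - k)).
  move=> jk; have -> : (j - k = 0)%N by lia.
  have k1 : (k.-1 < k)%N by lia.
  have := le_trans (vbase_exp j (k.-1 - j)) (_ : M (j + (k.-1 - j)) <= r).
  have -> : (j + (k.-1 - j) = k.-1)%N by lia.
  move/(_ (ltW (klt _ k1))); have -> : (k - j + 0 = (k.-1 - j).+1)%N by lia.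
  rewrite exprS mulrACA divff// mul1r exprVn -ler_pdivlMl ?exprn_gt0// mulrC => h1.
  by [].
have high j : (k <= j)%N -> r ^+ 2 / M j <= 2 * r * 2^-1 ^+ ((k - j) + (j - k)).
  move=> kj; have -> : (k - j = 0)%N by lia.
  rewrite ler_pdivrMr// add0n exprVn.
  have := vbase_exp k (j - k); rewrite subnKC// => h1.
  have h2 : r * 2 ^+ (j - k) <= M j.
    by apply: le_trans h1; rewrite mulrC ler_pM2l// exprn_gt0.
  apply: (@le_trans _ _ (r / 2 ^+ (j - k) * (r * 2 ^+ (j - k)))).
    by rewrite mulrACA mulVf ?mulr1 ?expr2// gt_eqF// exprn_gt0.
  rewrite -!mulrA; apply: (@le_trans _ _ (r * (2 ^- (j - k) * M j))).
    by rewrite ler_pM2l// ler_wpM2l// invr_ge0 exprn_ge0.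
  by rewrite ler_peMl ?ler1n// mulr_ge0 ?(ltW r0)// mulr_ge0 ?invr_ge0 ?exprn_ge0.
have fin a b j : ((k - a) + (a - k) <= (k - b) + (b - k))%N ->
    2 * r * 2^-1 ^+ ((k - b) + (b - k)) <= 2 * r * (w k a * w k b).
  by move=> ab; rewrite ler_pM2l ?mulr_gt0// half_le_w.
(* In every case the minimum is bounded by the term of whichever of [h] and [i] is farther from
   [k]. *)
have [ik|ki] := ltnP i k.
  apply: (@le_trans _ _ (M h)); first by rewrite ge_min lexx.
  apply: le_trans (low h _) _; first exact: leq_ltn_trans ik.
  by rewrite [w k h * _]mulrC; apply: fin => //; lia.
have [hk|kh] := ltnP h k; last first.
  apply: (@le_trans _ _ (r ^+ 2 / M i)); first by rewrite ge_min lexx orbT.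
  by apply: le_trans (high i _) _ => //; apply: fin => //; lia.
have [e|e] := leqP ((k - h) + (h - k)) ((k - i) + (i - k)).
  apply: (@le_trans _ _ (r ^+ 2 / M i)); first by rewrite ge_min lexx orbT.
  by apply: le_trans (high i _) _ => //; apply: fin.
apply: (@le_trans _ _ (M h)); first by rewrite ge_min lexx.
apply: le_trans (low h _) _ => //.
by rewrite [w k h * _]mulrC; apply: fin => //; exact: ltnW.
Qed.

Variable B : nat.
Hypothesis m_le : forall k, (m k <= B)%N.
Local Notation b := (B%:R : R).

Lemma level_zerosr i h : level i (fun t => (zeros i h t)%:R : R).
Proof. by move=> x y xy; rewrite (level_zeros _ xy). Qed.

(** All coordinates below [i] are prescribed, except that [h] may be free: the measure is [1 / M i],
    or [m h / M i] when [h < i]. *)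
Lemma avg_zeros i h x : (h <= i)%N ->
  avg (iota 0 i) (fun t => (zeros i h t)%:R) x <= b / M i.
Proof.
have m0 k : 0 < (m k)%:R :> R by rewrite ltr0n (leq_trans _ (m_ge2 k)).
have mb k : (m k)%:R <= b by rewrite ler_nat.
have M0 j : 0 < M j by exact: vbase_real_gt0.
have b1 : 1 <= b by apply: le_trans (mb 0%N); rewrite ler1n (leq_trans _ (m_ge2 _)).
have inv1 (g : G -> R) k (y : G) : level k g ->
    avg1 k (fun t => g t * (vcoord t k == 0)%:R) y = (m k)%:R^-1 * g y.
  move=> lg; rewrite -avg_seq1 avg_mull => [|q]; last first.
    by rewrite inE => /eqP ->; apply: level_coord_inv lg.
  by rewrite avg_seq1 avg1_coord0// mulrC.
have lz := level_zerosr.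
have diag j : avg (iota 0 j) (fun t => (zeros j j t)%:R) x = (M j)^-1.
  elim: j => [|j IH]; first by rewrite vbase0 invr1 /avg /= (_ : zeros 0 0 x)//; apply/forallP => -[].
  rewrite -addn1 iotaD avg_cat (_ : avg (iota (0 + j) 1) _ = fun y => (m j)%:R^-1 * (zeros j j y)%:R).
    by rewrite avgZ IH addn1 vbase_realS invfM mulrC.
  apply/funext => y; rewrite addn1 avg_seq1 -(inv1 (fun t => (zeros j j t)%:R))//.
  by rewrite -!avg_seq1; apply: eq_avg => z; rewrite zerosSS -mulnb natrM.
rewrite leq_eqVlt => /orP[/eqP ->|].
  by rewrite diag ler_peMl// invr_ge0 ltW.
suff off j : (h < j)%N -> avg (iota 0 j) (fun t => (zeros j h t)%:R) x = (m h)%:R / M j.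
  by move=> hi; rewrite off// ler_pM2r ?invr_gt0.
elim: j => // j IH; rewrite ltnS leq_eqVlt => /orP[/eqP ->|hj].
  rewrite -addn1 iotaD avg_cat (_ : avg (iota (0 + j) 1) _ = fun y => (zeros j j y)%:R).
    by rewrite diag addn1 vbase_realS invfM mulrC mulrVK// unitfE gt_eqF.
  apply/funext => y; rewrite avg_id// => [|q]; first by rewrite addn1 zerosS_eq.
  rewrite inE => /eqP -> z; rewrite addn1 !zerosS_eq.
  exact: (level_coord_inv (n := j) _ (lz j j)).
rewrite -addn1 iotaD avg_cat (_ : avg (iota (0 + j) 1) _ = fun y => (m j)%:R^-1 * (zeros j h y)%:R).
  by rewrite avgZ IH// addn1 vbase_realS invfM; ring.
apply/funext => y; rewrite addn1 avg_seq1 -(inv1 (fun t => (zeros j h t)%:R))//.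
by rewrite -!avg_seq1; apply: eq_avg => z; rewrite zerosS_lt// -mulnb natrM.
Qed.

Lemma vbase_threshold (r : R) : exists2 k, r <= M k & forall j, (j < k)%N -> M j < r.
Proof.
have ex : exists k, r <= M k.
  exists (Num.bound `|r|); apply: le_trans (ler_norm _) _.
  apply: le_trans (ltW (archi_boundP (normr_ge0 r))) _.
  by rewrite ler_nat ltnW// vbase_gt.
exists (ex_minn ex); case: ex_minnP => // k _ kmin j jk.
by rewrite ltNge; apply/negP => /kmin; rewrite leqNgt jk.
Qed.

(* Normalized so that, up to a constant, [vbase m n * majV n] bounds the conditional
   expectation at order [n] of every Fejer kernel of order at least [vbase m n]. *)
Definition majV n x : R := majU R n x / M n ^+ 2.

Lemma majV_ge0 n x : 0 <= majV n x.
Proof. by rewrite divr_ge0 ?majU_ge0 ?sqr_ge0. Qed.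

Lemma level_majV n : level n (majV n).
Proof. by move=> x y xy; rewrite /majV (level_majU _ xy). Qed.

Lemma majU_double_sum n x :
  majU R n x = \sum_(i < n.+1) \sum_(h < i.+1) M i * M h * (zeros i h x)%:R.
Proof.
apply: eq_bigr => i _; rewrite big_ord_recr /= /majX /majW /majY expr2.
by [].
Qed.

(** Scaling by [M n ^+ 2] turns the truncation level into [r ^+ 2] with [r = u * M n]. Truncating
    term by term leaves [b * Num.min (M h) (r ^+ 2 / M i)] for each pair, and the double geometric
    sum yields [98 = 2 * 7 * 7]. *)
Lemma avg_min_majV n (u : R) x : 0 < u ->
  avg (iota 0 n) (fun t => Num.min (majV n t) (u ^+ 2)) x <= 98 * b * u / M n.
Proof.
move=> u0.
have M0 j : 0 < M j by exact: vbase_real_gt0.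
pose r := u * M n; have r0 : 0 < r by rewrite mulr_gt0.
have [k rk klt] := vbase_threshold r.
have -> : avg (iota 0 n) (fun t => Num.min (majV n t) (u ^+ 2)) x =
    (M n ^+ 2)^-1 * avg (iota 0 n) (fun t => Num.min (majU R n t) (r ^+ 2)) x.
  rewrite -avgZ; apply: eq_avg => t.
  by rewrite minr_pMr ?invr_ge0 ?sqr_ge0// /majV [_ / _]mulrC /r exprMn mulrCA mulVf ?mulr1// gt_eqF// exprn_gt0.
have -> : 98 * b * u / M n = (M n ^+ 2)^-1 * (98 * b * r).
  by rewrite /r; field; rewrite gt_eqF.
rewrite ler_wpM2l ?invr_ge0 ?sqr_ge0//.
apply: (@le_trans _ _ (avg (iota 0 n) (fun t => \sum_(i < n.+1) \sum_(h < i.+1)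
    Num.min (M i * M h) (r ^+ 2) * (zeros i h t)%:R) x)).
  apply: ler_avg => t; rewrite majU_double_sum.
  apply: le_trans (min_sum_le _ (sqr_ge0 r) _) _ => [i _|].
    by apply: sumr_ge0 => h _; rewrite !mulr_ge0.
  apply: ler_sum => i _.
  apply: le_trans (min_sum_le _ (sqr_ge0 r) _) _ => [h _|]; first by rewrite !mulr_ge0.
  apply: ler_sum => h _; case: (zeros _ _ _); rewrite ?mulr1 ?mulr0//.
  by rewrite ge_min lexx.
rewrite avg_sum; apply: (@le_trans _ _ (\sum_(i < n.+1) \sum_(h < i.+1) 2 * b * r * (w k h * w k i))).
  apply: ler_sum => i _; rewrite avg_sum; apply: ler_sum => h _; rewrite avgZ.
  have hi : (h <= i)%N by rewrite -ltnS.
  have := @level_avg_widen _ m_ge2 _ 0 i n _ x _ (@level_zerosr i h).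
  rewrite !subn0 => -> ; last by rewrite -ltnS.
  apply: le_trans (ler_wpM2l _ (avg_zeros x hi)) _.
    by rewrite le_min mulr_ge0 ?sqr_ge0// ltW.
  have -> : Num.min (M i * M h) (r ^+ 2) * (b / M i) = b * Num.min (M h) (r ^+ 2 / M i).
    have -> : Num.min (M i * M h) (r ^+ 2) = M i * Num.min (M h) (r ^+ 2 / M i).
      by rewrite minr_pMr ?ltW// mulrCA divff ?mulr1// gt_eqF.
    by move: (Num.min _ _) => z; field; rewrite gt_eqF.
  have := min_vbase_le r0 rk klt hi.
  by move/(ler_wpM2l (ler0n R B))/le_trans; apply; lra.
apply: (@le_trans _ _ (\sum_(i < n.+1) \sum_(h < n.+1) 2 * b * r * (w k h * w k i))).
  apply: ler_sum => i _; rewrite -!(big_mkord xpredT (fun h => 2 * b * r * (w k h * w k i))).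
  rewrite [leRHS](big_cat_nat _ (_ : i.+1 <= n.+1)%N)//= lerDl sumr_ge0// => h _.
  by rewrite !mulr_ge0 ?exprn_ge0 ?(ltW r0)//; lra.
have -> : \sum_(i < n.+1) \sum_(h < n.+1) 2 * b * r * (w k h * w k i) =
    2 * b * r * ((\sum_(i < n.+1) w k i) * (\sum_(i < n.+1) w k i)).
  rewrite mulr_sumr mulr_sumr; apply: eq_bigr => i _.
  by rewrite mulr_suml mulr_sumr.
rewrite (_ : 98 * b * r = 2 * b * r * (7 * 7)); last by ring.
have S0 : 0 <= \sum_(i < n.+1) w k i by rewrite sumr_ge0// => i _; rewrite exprn_ge0//; lra.
apply: ler_wpM2l; first by rewrite !mulr_ge0// ltW.
by apply: ler_pM; rewrite ?sum_two_sided_geometric.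
Qed.

(** The product of the moduli cancels the normalization of [avg], which leaves a plain sum over
    shifts, and truncation is subadditive on such a sum. Each shift corresponds to one cylinder, so
    each atom gets truncated separately. *)
Lemma min_avg_le (l : seq nat) (g : G -> R) (a s : R) x :
  0 <= a -> 0 <= s -> (forall t, 0 <= g t) ->
  Num.min (a * ((\prod_(k <- l) (m k)%:R) * avg l g x)) s <=
  (\prod_(k <- l) (m k)%:R) * avg l (fun t => Num.min (a * g t) s) x.
Proof.
move=> a0 s0 g0; elim: l x => [|k l IH] x; first by rewrite big_nil !mul1r.
have mk0 : (m k)%:R != 0 :> R by rewrite pnatr_eq0 -lt0n (leq_trans _ (m_ge2 k)).
have step (h : G -> R) : (\prod_(j <- k :: l) (m j)%:R) * avg (k :: l) h x =
    \sum_(i < m k) (\prod_(j <- l) (m j)%:R) * avg l h (vadd (vunit m k i) x).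
  rewrite big_cons avg_cons /avg1 mulr_sumr.
  by rewrite mulr_sumr; apply: eq_bigr => i _; field.
rewrite !step mulr_sumr; apply: le_trans (min_sum_le _ s0 _) _ => [i _|].
  by rewrite !mulr_ge0 ?avg_ge0 ?prodr_ge0.
by apply: ler_sum => i _; exact: IH.
Qed.

Lemma vbase_prod_iota n : \prod_(k <- iota 0 n) (m k)%:R = M n.
Proof. by rewrite -natr_prod /vbase -(big_mkord xpredT m) /index_iota subn0. Qed.

End truncated_kernel.

(** * Convolution with Fejer kernels *)

Section fejer_operator.
Variable R : realType.
Variable m : nat -> nat.
Hypothesis m_ge2 : forall k, (2 <= m k)%N.
Local Notation G := (vilenkin m).
Local Notation C := R[i].
Local Notation M i := ((vbase m i)%:R : R).
Local Notation "`| z |c" := (Normc.normc z) (format "`| z |c").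
Implicit Types (x y t : G) (i j k n N : nat).
Variable x0 : G.

(** Conjugating the kernel reflects it, so this is a convolution in the usual sense. The point [x0]
    only serves to evaluate an average that is constant for integrands of level [N]. *)
Definition fejer_conv N j (g : G -> C) x : C :=
  avg (iota 0 N) (fun t => g (vadd x t) * conjc (fejer_sum R j t)) x0.

Lemma fejer_conv_sum N j (I : Type) (r : seq I) (P : pred I) (F : I -> G -> C) x :
  fejer_conv N j (fun y => \sum_(i <- r | P i) F i y) x =
  \sum_(i <- r | P i) fejer_conv N j (F i) x.
Proof. by rewrite /fejer_conv -avg_sum; apply: eq_avg => t; rewrite mulr_suml. Qed.

Lemma fejer_convD N j (f g : G -> C) x :
  fejer_conv N j (fun y => f y + g y) x = fejer_conv N j f x + fejer_conv N j g x.
Proof. by rewrite /fejer_conv -avgD; apply: eq_avg => t; rewrite mulrDl. Qed.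

Lemma eq_fejer_conv N j (f g : G -> C) x : f =1 g -> fejer_conv N j f x = fejer_conv N j g x.
Proof. by move=> fg; apply: eq_avg => t; rewrite fg. Qed.

Lemma conj_fejer_sum j t : conjc (fejer_sum R j t) = \sum_(k < j) \sum_(i < k) conjc (vilenkin_fun i t).
Proof.
by rewrite /fejer_sum raddf_sum; apply: eq_bigr => k _; rewrite /dirichlet raddf_sum.
Qed.

(** After expansion into characters, orthonormality on the first [N] coordinates selects the
    coefficients; it covers all characters of the kernel because [j <= vbase m N]. *)
Lemma sum_partial_sum (c : nat -> C) N j x : (j <= vbase m N)%N ->
  \sum_(k < j) partial_sum c k x = fejer_conv N j (partial_sum c (vbase m N)) x.
Proof.
move=> jN; rewrite /fejer_conv.
transitivity (avg (iota 0 N) (fun t => \sum_(k < j) \sum_(i < k) \sum_(l < vbase m N)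
    (c l * vilenkin_fun l x) * (vilenkin_fun l t * conjc (vilenkin_fun i t))) x0).
  rewrite avg_sum; apply: eq_bigr => k _; rewrite avg_sum; apply: eq_bigr => i _.
  rewrite avg_sum.
  have iN : (i < vbase m N)%N by rewrite (leq_trans (ltn_ord i))// (leq_trans (ltnW (ltn_ord k))).
  rewrite (bigD1 (Ordinal iN))//= big1 ?addr0.
    by rewrite avgZ vilenkin_fun_orthonormal// eqxx mulr1.
  move=> l li; rewrite avgZ vilenkin_fun_orthonormal//.
  by rewrite (_ : (l == i :> nat) = false) ?mulr0//; apply/negbTE.
apply: eq_avg => t; rewrite conj_fejer_sum mulr_sumr; apply: eq_bigr => k _.
rewrite mulr_sumr; apply: eq_bigr => i _; rewrite /partial_sum mulr_suml.
by apply: eq_bigr => l _; rewrite vilenkin_funD//; ring.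
Qed.

Variable B : nat.
Hypothesis m_le : forall k, (m k <= B)%N.
Local Notation b := (B%:R : R).

(** As a function of [t], [chi (vadd x t)] has level [n], so the kernel may be replaced by its
    conditional expectation of order [n], which [avg_normc_fejer_sum] controls. *)
Lemma normc_fejer_conv_le N j n (g : G -> C) (chi : G -> bool) (a : R) x :
  0 <= a -> (n <= N)%N -> level n chi -> (vbase m n <= j < vbase m N)%N ->
  (forall y, `|g y|c <= a * (chi y)%:R) ->
  `|fejer_conv N j g x|c <=
  a * (30 * b ^+ 3) * j%:R * (M n * avg (iota 0 n) (fun t => (chi (vadd x t))%:R * majV R n t) x0).
Proof.
move=> a0 nN lchi jn ga.
have Mn0 : M n != 0 by rewrite gt_eqF// vbase_real_gt0.
apply: le_trans (normc_avg _ _ _) _.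
have lc : level n (fun t => (chi (vadd x t))%:R : R).
  by move=> y z yz; rewrite (level_vadd x lchi yz).
apply: (@le_trans _ _ (avg (iota 0 N) (fun t => a * ((chi (vadd x t))%:R * `|fejer_sum R j t|c)) x0)).
  apply: ler_avg => t; rewrite Normc.normcM normc_conj mulrA ler_wpM2r ?normc_ge0//.
rewrite avgZ -!mulrA ler_wpM2l// (avg_split m_ge2 _ x0 nN lc).
apply: (@le_trans _ _ (avg (iota 0 N) (fun t => (chi (vadd x t))%:R *
    (30 * b ^+ 3 * (j%:R / M n) * majU R n t)) x0)).
  apply: ler_avg => t; rewrite ler_wpM2l//; exact: avg_normc_fejer_sum.
have := @level_avg_widen _ m_ge2 _ 0 n N (fun t => (chi (vadd x t))%:R * majV R n t) x0 nN.
rewrite !subn0 => <-; last by move=> y z yz; rewrite (lc _ _ yz) (@level_majV R m _ _ _ yz).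
rewrite -!avgZ; apply: ler_avg => t; rewrite le_eqVlt; apply/orP; left; apply/eqP.
by rewrite /majV; field.
Qed.

(** This is the previous estimate at order 0, where [majV] equals 1. *)
Lemma normc_fejer_conv_bounded N j (g : G -> C) (a : R) x :
  0 <= a -> (0 < j < vbase m N)%N -> (forall y, `|g y|c <= a) ->
  `|fejer_conv N j g x|c <= a * (30 * b ^+ 3) * j%:R.
Proof.
move=> a0 /andP[j0 jN] ga.
have := @normc_fejer_conv_le N j 0 g (fun=> true) a x a0 (leq0n _).
rewrite vbase0 j0 jN => /(_ _ isT) h; apply: le_trans (h _ _) _ => //.
  by move=> y; rewrite mulr1.
rewrite /avg /= !mul1r (_ : majV R 0 x0 = 1) ?mulr1//.
rewrite /majV /majU big_ord1 /majX /majW big_ord0 /majY vbase0 (_ : zeros 0 0 x0).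
  by rewrite !expr1n add0r !mulr1 divr1.
by apply/forallP => -[].
Qed.

End fejer_operator.

(** * Stopping times and the atomic decomposition *)

Section stopping.
Variable R : realType.
Variable m : nat -> nat.
Hypothesis m_ge2 : forall k, (2 <= m k)%N.
Local Notation G := (vilenkin m).
Local Notation C := R[i].
Local Notation M i := ((vbase m i)%:R : R).
Local Notation "`| z |c" := (Normc.normc z) (format "`| z |c").
Implicit Types (x y t : G) (i j k n N : nat) (th : R).
Variable c : nat -> C.

(** Martingales are handled through their coefficients: each one has this form by [martingaleE], and
    each sequence [c] gives one by [mart_martingale]. *)
Definition mart n : G -> C := partial_sum c (vbase m n).

Definition mart_diff n x : C := if n is k.+1 then mart n x - mart k x else mart 0 x.

Lemma level_partial_sum n N : (n <= vbase m N)%N -> level N (partial_sum c n : G -> C).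
Proof.
move=> nN; apply: level_sum => i _ x y xy; congr (_ * _).
by apply: (level_vilenkin_fun _ m_ge2 _ xy); exact: leq_trans (ltn_ord i) nN.
Qed.

Lemma level_mart n : level n (mart n).
Proof. exact: level_partial_sum. Qed.

Lemma avg_mart_diff n N x : (n < N)%N ->
  avg (iota n (N - n)) (mart_diff n.+1) x = 0.
Proof.
move=> nN; have le : (vbase m n <= vbase m n.+1)%N by rewrite leq_vbase.
transitivity (avg (iota n (N - n)) (fun y => \sum_(vbase m n <= l < vbase m n.+1) c l * vilenkin_fun l y) x).
  apply: eq_avg => y; rewrite /mart_diff /mart /partial_sum.
  rewrite -!(big_mkord xpredT (fun l => c l * vilenkin_fun l y)).
  by rewrite (big_cat_nat _ le)//= [X in X - _]addrC addrK.
rewrite avg_sum big1_seq// => l; rewrite mem_index_iota => /andP[_ /andP[nl lN]].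
rewrite avgZ avg_vilenkin_fun_eq0 ?mulr0// nl (leq_trans lN)// leq_vbase//.
Qed.

(* The supremum of [mart n] over the cylinder of order [n.-1] containing [x]
   is at most [th]: this makes the stopping time predictable. *)
Definition below th n x : bool :=
  if n is k.+1 then [forall a : 'I_(m k), `|mart n (vadd (vunit m k a) x)|c <= th]
  else `|mart 0 x|c <= th.

(* The stopping time is the first order at which [below th] fails: [running th n]
   says that it is at least [n] and [stopping th n] that it is [n]. *)
Definition running th n x : bool := [forall i : 'I_n, below th i x].

Definition stopping th n x : bool := running th n x && ~~ below th n x.

Lemma below_mart th n x : below th n x -> `|mart n x|c <= th.
Proof.
case: n => // k /forallP h; have := h (Ordinal (leq_trans (isT : 0 < 2)%N (m_ge2 k))).
by rewrite /= vunit0.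
Qed.

(** For [n = k.+1] the predicate runs over all values of coordinate [k], so changing that coordinate
    only permutes the shifts. *)
Lemma level_below th n : level n.-1 (below th n).
Proof.
case: n => [|k] x y xy /=; first by rewrite (level_mart xy).
suff sub z w : (forall i, (i < k)%N -> vcoord z i = vcoord w i) -> below th k.+1 z -> below th k.+1 w.
  by apply/idP/idP; apply: sub => // i ik; rewrite xy.
move=> zw /forallP /= bz; apply/forallP => a.
have [e [eM ewE]] : exists e : nat, (e < m k)%N /\ (a%:R + vcoord w k = e%:R + vcoord z k :> 'Z_(m k)).
  pose d : 'Z_(m k) := a%:R + vcoord w k - vcoord z k.
  exists d; split; first by apply: (leq_trans (ltn_ord d)); rewrite Zp_cast.
  by rewrite natr_Zp subrK.
have := bz (Ordinal eM); rewrite (level_mart (y := vadd (vunit m k a) w))// => i.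
rewrite ltnS leq_eqVlt => /orP[/eqP ->|ik].
  by rewrite !vcoord_vunit eqxx ewE.
by rewrite !vcoord_vunit_neq ?zw// ltn_eqF.
Qed.

Lemma runningS th n x : running th n.+1 x = running th n x && below th n x.
Proof.
apply/forallP/andP => [h|[/forallP h b] i].
  by split; [apply/forallP => i; exact: (h (widen_ord (leqnSn n) i))|exact: (h ord_max)].
have [iN|] := ltnP i n; first exact: (h (Ordinal iN)).
by move=> ni; rewrite (_ : nat_of_ord i = n)//; apply/eqP; rewrite eqn_leq ni -ltnS ltn_ord.
Qed.

Lemma running0 th x : running th 0 x.
Proof. by apply/forallP => -[]. Qed.

Lemma running_le th n n' x : (n <= n')%N -> running th n' x -> running th n x.
Proof.
move=> nn' /forallP h; apply/forallP => i; exact: (h (widen_ord nn' i)).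
Qed.

Lemma below_homo th th' n x : th <= th' -> below th n x -> below th' n x.
Proof.
move=> tt; case: n => [|k] /=; first by move/le_trans; apply.
by move=> /forallP h; apply/forallP => a; exact: le_trans (h a) tt.
Qed.

Lemma running_homo th th' n x : th <= th' -> running th n x -> running th' n x.
Proof. by move=> tt /forallP h; apply/forallP => i; exact: below_homo (h i). Qed.

Lemma level_running th n : level n.-2 (running th n).
Proof.
move=> x y xy; apply: eq_forallb => i; apply: level_le (@level_below th i) _ _ xy.
by have := ltn_ord i; lia.
Qed.

Lemma level_stopping th n : level n.-1 (stopping th n).
Proof.
move=> x y xy; rewrite /stopping.
have -> : below th n x = below th n y by exact: (@level_below th n).
have -> : running th n x = running th n y.
  have le : (n.-2 <= n.-1)%N by exact: leq_pred.
  exact: (level_le le (@level_running th n)).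
by [].
Qed.

Lemma sum_stopping th n x : (\sum_(i < n) stopping th i x + running th n x = 1)%N.
Proof.
elim: n => [|n IH]; first by rewrite big_ord0 running0.
rewrite big_ord_recr /= -addnA -[RHS]IH; congr (_ + _)%N.
by rewrite runningS /stopping; case: running; case: below.
Qed.

(** A martingale transform: the difference of order [i] is kept only if [below] holds up to order
    [i] included, so the jump beyond [th] is never taken. The factor has level [i.-1], which
    preserves the cancellation of the differences. *)
Definition stopped th N x : C := \sum_(i < N.+1) mart_diff i x * (running th i.+1 x)%:R.

Lemma normc_stopped_le th N x : 0 <= th -> `|stopped th N x|c <= th.
Proof.
move=> th0; rewrite /stopped.
(* The induction also needs that the stopped sum is the martingale itself as long as it runs. *)
suff [] : `|\sum_(i < N.+1) mart_diff i x * (running th i.+1 x)%:R|c <= th /\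
  (running th N.+1 x -> \sum_(i < N.+1) mart_diff i x * (running th i.+1 x)%:R = mart N x) by [].
elim: N => [|N [IH1 IH2]].
  rewrite big_ord1 /=; case: (boolP (running th 1 x)) => [|_].
    by rewrite runningS => /andP[_ /below_mart h]; rewrite mulr1.
  by rewrite mulr0 Normc.normc0.
rewrite big_ord_recr /=; case: (boolP (running th N.+2 x)) => [h|_]; last first.
  by rewrite mulr0 addr0; split.
move: (h); rewrite runningS => /andP[h1 /below_mart h2].
by rewrite mulr1 IH2// addrC subrK; split.
Qed.

Lemma stopped_mart th N : (forall n x, (n <= N)%N -> `|mart n x|c <= th) ->
  stopped th N =1 mart N.
Proof.
move=> h x; have r n : (n <= N.+1)%N -> running th n x.
  move=> nN; apply/forallP => i; have iN : (i <= N)%N by have := ltn_ord i; lia.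
  by case: (nat_of_ord i) iN => [|k] kN /=; [exact: h|apply/forallP => a; exact: h].
rewrite /stopped (eq_bigr (fun i : 'I_N.+1 => mart_diff i x)); last first.
  by move=> i _; rewrite r ?mulr1// ltn_ord.
elim: N {h r} => [|N IH]; first by rewrite big_ord1.
by rewrite big_ord_recr /= IH addrC subrK.
Qed.

(** * Atoms between two thresholds *)

Section atoms.
Variables (th th' : R) (N : nat).
Hypotheses (th_ge0 : 0 <= th) (th_le : th <= th').

(* The sum of all the atoms of height between [th] and [th']; multiplying by
   [stopping th n] selects those supported by cylinders of order [n.-1]. *)
Definition atom_sum x : C := stopped th' N x - stopped th N x.

Lemma normc_atom_sum x : `|atom_sum x|c <= th + th'.
Proof.
rewrite addrC; apply: le_trans (le_normcD _ _) _; rewrite normcN.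
by rewrite lerD// normc_stopped_le// (le_trans th_ge0).
Qed.

Lemma atom_sumE x : atom_sum x =
  \sum_(i < N.+1) mart_diff i x * ((running th' i.+1 x)%:R - (running th i.+1 x)%:R).
Proof.
rewrite /atom_sum /stopped -sumrN -big_split /=; apply: eq_bigr => i _.
by rewrite mulrBr.
Qed.

(** The stopping events are disjoint, and where none of them occurs up to order [N] both transforms
    keep every difference, so [atom_sum] vanishes. *)
Lemma atom_sum_split x :
  atom_sum x = \sum_(n < N.+1) atom_sum x * (stopping th n x)%:R.
Proof.
rewrite -mulr_sumr -natr_sum; have := sum_stopping th N.+1 x.
case: (boolP (running th N.+1 x)) => [r|_]; last by rewrite addn0 => ->; rewrite mulr1.
move=> _; suff -> : atom_sum x = 0 by rewrite mul0r.
rewrite atom_sumE big1// => i _.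
have ri : running th i.+1 x by exact: running_le r.
by rewrite ri (running_homo th_le ri) subrr mulr0.
Qed.

(* Martingale differences beyond the stopping time have zero conditional expectation,
   whereas kernels of order at most [vbase m n.-1] do not see the later coordinates. *)
Lemma fejer_conv_atom_eq0 x0 j n x : (n <= N)%N -> (j <= vbase m n.-1)%N ->
  fejer_conv x0 N j (fun y => atom_sum y * (stopping th n y)%:R) x = 0.
Proof.
move=> nN jn.
rewrite (@eq_fejer_conv _ _ x0 N j _ (fun y => \sum_(i < N.+1) mart_diff i y *
   (((running th' i.+1 y)%:R - (running th i.+1 y)%:R) * (stopping th n y)%:R))); last first.
  by move=> y; rewrite atom_sumE mulr_suml; apply: eq_bigr => i _; rewrite mulrA.
rewrite fejer_conv_sum big1// => i _; rewrite /fejer_conv.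
have [iltn|nlei] := ltnP i n.
  rewrite -[RHS](avg_cst m_ge2 (iota 0 N) (0 : C) x0); apply: eq_avg => t.
  set y := vadd x t; rewrite /stopping; case: (boolP (running th n y)) => [r|_]; last by rewrite !mulr0 mul0r.
  have ri : running th i.+1 y by exact: running_le r.
  by rewrite ri (running_homo th_le ri) subrr mul0r mulr0 mul0r.
case: n nN jn nlei => [|n] nN jn nlei.
  (* Here [j <= vbase m 0 = 1], and the kernel itself vanishes since its only possible term is
     [dirichlet 0]. *)
  have L0 t : fejer_sum R j t = 0.
    move: jn; rewrite /= vbase0; case: j => [|[|//]] _; first by rewrite /fejer_sum big_ord0.
    by rewrite /fejer_sum big_ord1 /dirichlet big_ord0.
  rewrite -[RHS](avg_cst m_ge2 (iota 0 N) (0 : C) x0); apply: eq_avg => t.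
  by rewrite L0 conjc0 mulr0.
case iE : (nat_of_ord i) nlei => [//|k]; rewrite ltnS => nk.
have kN : (k < N)%N by have := ltn_ord i; rewrite iE ltnS.
pose W t : C := ((running th' k.+2 (vadd x t))%:R - (running th k.+2 (vadd x t))%:R) *
   (stopping th n.+1 (vadd x t))%:R * conjc (fejer_sum R j t).
have lW : level k W.
  move=> y z yz; rewrite /W.
  have yz' : forall q, (q < k)%N -> vcoord (vadd x y) q = vcoord (vadd x z) q.
    by move=> q qk; rewrite !vcoord_vadd yz.
  have -> : running th' k.+2 (vadd x y) = running th' k.+2 (vadd x z).
    exact: (@level_running th' k.+2 _ _ yz').
  have -> : running th k.+2 (vadd x y) = running th k.+2 (vadd x z).
    exact: (@level_running th k.+2 _ _ yz').
  have -> : stopping th n.+1 (vadd x y) = stopping th n.+1 (vadd x z).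
    exact: (level_le nk (@level_stopping th n.+1) yz').
  by rewrite (level_le nk (level_fejer_sum R m_ge2 jn) yz).
transitivity (avg (iota 0 N) (fun t => W t * mart_diff k.+1 (vadd x t)) x0).
  by apply: eq_avg => t; rewrite /W; ring.
rewrite (avg_split m_ge2 _ x0 (ltnW kN) lW).
rewrite -[RHS](avg_cst m_ge2 (iota 0 N) (0 : C) x0); apply: eq_avg => t.
by rewrite avg_vadd avg_mart_diff// mulr0.
Qed.

Variable B : nat.
Hypothesis m_le : forall k, (m k <= B)%N.
Local Notation b := (B%:R : R).

(** Orders with [j < vbase m n.-1] drop out by cancellation. For the others the kernel is averaged
    at order [n.-1], the level of the stopping event. *)
Lemma normc_fejer_conv_atom x0 j x : (0 < j < vbase m N)%N ->
  `|fejer_conv x0 N j atom_sum x|c <= \sum_(n < N.+1)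
    (th + th') * (30 * b ^+ 3) * j%:R * (M n.-1 *
      avg (iota 0 n.-1) (fun t => (stopping th n (vadd x t))%:R * majV R n.-1 t) x0).
Proof.
move=> /andP[j0 jN]; rewrite (eq_fejer_conv _ _ _ _ (atom_sum_split)) fejer_conv_sum.
apply: le_trans (normc_sum _ _ _) _; apply: ler_sum => n _.
have nN : (n <= N)%N by rewrite -ltnS.
have a0 : 0 <= th + th' by rewrite addr_ge0// (le_trans th_ge0).
have [nj|jn] := leqP (vbase m n.-1) j; last first.
  rewrite (_ : fejer_conv _ _ _ _ _ = 0) ?Normc.normc0; last first.
    by apply: fejer_conv_atom_eq0 => //; exact: ltnW.
  rewrite !mulr_ge0 ?exprn_ge0// avg_ge0// => t.
  by rewrite mulr_ge0 ?majV_ge0.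
refine (@normc_fejer_conv_le R m m_ge2 x0 B m_le N j n.-1 _ (stopping th n) _ x a0 _ (@level_stopping th n) _ _).
- exact: leq_trans (leq_pred _) nN.
- by rewrite nj.
- by move=> y; rewrite Normc.normcM normc_nat ler_wpM2r// normc_atom_sum.
Qed.

End atoms.

End stopping.

(** * The weak-type inequality for finitely many coordinates *)

Section weak_type_level.
Variable R : realType.
Variable m : nat -> nat.
Hypothesis m_ge2 : forall k, (2 <= m k)%N.
Variable B : nat.
Hypothesis m_le : forall k, (m k <= B)%N.
Local Notation G := (vilenkin m).
Local Notation C := R[i].
Local Notation M i := ((vbase m i)%:R : R).
Local Notation b := (B%:R : R).
Local Notation "`| z |c" := (Normc.normc z) (format "`| z |c").
Implicit Types (x y t : G) (i j k n N : nat) (th : R).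
Variable c : nat -> C.

Let b_ge1 : 1 <= b.
Proof. by rewrite ler1n (leq_trans _ (m_le 0))// (leq_trans _ (m_ge2 0)). Qed.

Let b_gt0 : 0 < b.
Proof. exact: lt_le_trans b_ge1. Qed.

(** A geometric sum is controlled by its last term. This later turns distribution functions at the
    thresholds [4 ^ k] into the integral of a square root. *)
Lemma sum_pow2_lt (y : R) K : 0 <= y ->
  \sum_(k < K) 2 ^+ k * (2 ^+ k < y)%R%:R <= 2 * y.
Proof.
move=> y0; elim: K => [|K IH]; first by rewrite big_ord0 mulr_ge0.
rewrite big_ord_recr /=; case: ltP => [Ky|_]; last by rewrite mulr0 addr0.
apply: (@le_trans _ _ (2 ^+ K - 1 + 2 ^+ K * 1)); last lra.
rewrite lerD2r; apply: (@le_trans _ _ (\sum_(k < K) 2 ^+ k)).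
  by apply: ler_sum => k _; case: ltP => _; rewrite ?mulr1 ?mulr0// exprn_ge0.
by rewrite subrX1 (_ : 2 - 1 = 1) ?mul1r//; ring.
Qed.

(* Each stopped cylinder of order [n.-1] contains a cylinder of order [n], of
   comparable measure, on which the martingale exceeds [th]. *)
Lemma avg_stopping_le th n N x : (n <= N)%N ->
  avg (iota 0 N) (fun x => (stopping c th n x)%:R) x <=
  b * avg (iota 0 N) (fun x => (stopping c th n x)%:R * (th < `|mart c n x|c)%R%:R) x.
Proof.
case: n => [_|k kN]; rewrite -avgZ.
  apply: ler_avg => y; rewrite /stopping running0 /= -ltNge.
  by case: ltP => _; rewrite ?mulr1 ?mulr0.
pose F y : R := (stopping c th k.+1 y)%:R * (th < `|mart c k.+1 y|c)%R%:R.
have F0 y : 0 <= F y by rewrite mulr_ge0.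
apply: (@le_trans _ _ (avg (iota 0 N) (fun y => b * avg1 k F y) x)).
  apply: ler_avg => y; case: (boolP (stopping c th k.+1 y)) => [st|_]; last first.
    by rewrite mulr_ge0// mulr_ge0 ?invr_ge0// sumr_ge0.
  move: (st); rewrite {1}/stopping /= negb_forall => /andP[_ /existsP[a]].
  rewrite -ltNge => ha.
  have m0 : 0 < (m k)%:R :> R by rewrite ltr0n (leq_trans _ (m_ge2 k)).
  rewrite /avg1 mulrA; apply: (@le_trans _ _ (1 * F (vadd (vunit m k a) y))).
    rewrite mul1r /F ha mulr1.
    suff -> : stopping c th k.+1 (vadd (vunit m k a) y) by [].
    by rewrite (coord_invn _ _ (level_coord_inv (leqnn k) (@level_stopping _ _ m_ge2 c th k.+1))).
  apply: ler_pM => //; first by rewrite ler_pdivlMr// mul1r ler_nat.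
  by rewrite (bigD1 a)//= lerDl sumr_ge0.
have -> : avg (iota 0 N) (fun y => b * avg1 k F y) x = b * avg (iota 0 N) F x.
  by rewrite (avgZ (iota 0 N) b (avg1 k F)) avg_avg1// mem_iota.
by rewrite avgZ.
Qed.

(** By translation invariance the inner average of [g] does not depend on [t], so the stopped set
    enters only through its measure. *)
Lemma avg_conv N (l : seq nat) (g Q : G -> R) x y : level N g ->
  avg l (fun t => avg (iota 0 N) (fun z => g (vadd z t) * Q t) x) y =
  avg (iota 0 N) g x * avg l Q y.
Proof.
move=> lg; rewrite -avgZ; apply: eq_avg => t; rewrite avgZr; congr (_ * _).
transitivity (avg (iota 0 N) (fun z => g (vadd t z)) x).
  by apply: eq_avg => z; rewrite vaddC.
by rewrite avg_vadd; exact: avg_iota0_cst.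
Qed.

Lemma mart_bounded N : exists S : R, forall n x, (n <= N)%N -> `|mart c n x|c <= S.
Proof.
exists (\sum_(l < vbase m N) `|c l|c) => n x nN.
apply: le_trans (normc_sum _ _ _) _.
rewrite -!(big_mkord xpredT (fun l => `|c l * vilenkin_fun l x|c)) -!(big_mkord xpredT (fun l => `|c l|c)).
rewrite [leRHS](big_cat_nat _ (leq_vbase m_ge2 nN))//=.
apply: (@le_trans _ _ (\sum_(0 <= l < vbase m n) `|c l|c)).
  by apply: ler_sum => l _; rewrite Normc.normcM normc_vilenkin_fun mulr1.
by rewrite lerDl sumr_ge0// => l _; exact: normc_ge0.
Qed.

Lemma weak_type_level N (lam : R) (phi : G -> R) x0 : 0 < lam ->
  (forall n x, (n <= N)%N -> `|mart c n x|c <= phi x) ->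
  avg (iota 0 N) (fun x => [exists j : 'I_(vbase m N),
     (0 < j)%N && (lam * j%:R < `|\sum_(k < j) partial_sum c k x|c)%R]%:R) x0 <=
  196 * b ^+ 2 * Num.sqrt (300 * b ^+ 3 / lam) *
    avg (iota 0 N) (fun x => Num.sqrt (phi x)) x0.
Proof.
move=> lam0 phi_ge.
(* Between consecutive thresholds [th k + th k.+1 = 5 * eps * 4 ^+ k]; with the kernel constant
   [30 * b ^+ 3] this makes [150 * b ^+ 3], and [eps] is chosen such that the product is
   [s * 4 ^+ k]. *)
pose C1 : R := 150 * b ^+ 3; have C10 : 0 < C1 by rewrite mulr_gt0// exprn_gt0.
pose eps : R := lam / (2 * C1); have eps0 : 0 < eps by rewrite divr_gt0// mulr_gt0.
pose s : R := lam / 2; have s0 : 0 < s by rewrite divr_gt0.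
have sE : s = C1 * eps by rewrite /s /eps; field; rewrite gt_eqF.
pose th k : R := eps * 4 ^+ k.
have th0 k : 0 <= th k by rewrite mulr_ge0 ?(ltW eps0)// exprn_ge0.
have th_le k : th k <= th k.+1.
  by rewrite ler_pM2l// ler_weXn2l// ler1n.
(* Above the last threshold nothing is stopped, so the telescoping sum of stopped parts ends at the
   martingale itself. *)
have [K hK] : exists K, forall n x, (n <= N)%N -> `|mart c n x|c <= th K.
  have [S hS] := mart_bounded N; exists (Num.bound `|S / eps|) => n x nN.
  apply: le_trans (hS n x nN) _; rewrite /th mulrC -ler_pdivrMr//.
  apply: le_trans (ler_norm _) _; apply: le_trans (ltW (archi_boundP (normr_ge0 _))) _.
  by rewrite -natrX ler_nat ltnW// ltn_expl.
pose piece k n x := M n.-1 *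
  avg (iota 0 n.-1) (fun t => (stopping c (th k) n (vadd x t))%:R * majV R n.-1 t) x0.
have piece0 k n x : 0 <= piece k n x.
  by rewrite mulr_ge0// avg_ge0// => t; rewrite mulr_ge0 ?majV_ge0.
pose bad x := \sum_(k < K) \sum_(n < N.+1) s * 4 ^+ k * piece k n x.
(* The part stopped at [th 0] contributes at most [s / 5] after division by [j]. As [lam = 2 * s],
   the atoms must account for more than [s]. *)
have step1 x : [exists j : 'I_(vbase m N),
     (0 < j)%N && (lam * j%:R < `|\sum_(k < j) partial_sum c k x|c)%R] -> s < bad x.
  move=> /existsP[j /andP[j0]]; rewrite (sum_partial_sum m_ge2 x0 c x (ltnW (ltn_ord j))).
  have dec y : partial_sum c (vbase m N) y =
      stopped c (th 0%N) N y + \sum_(k < K) atom_sum c (th k) (th k.+1) N y.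
    rewrite -[LHS](stopped_mart hK) -(big_mkord xpredT (fun k => atom_sum c (th k) (th k.+1) N y)).
    by rewrite /atom_sum (telescope_sumr (fun k => stopped c (th k) N y))// addrC subrK.
  have -> : fejer_conv x0 N j (partial_sum c (vbase m N)) x =
      fejer_conv x0 N j (stopped c (th 0%N) N) x +
      \sum_(k < K) fejer_conv x0 N j (atom_sum c (th k) (th k.+1) N) x.
    rewrite (eq_fejer_conv _ _ _ _ dec) fejer_convD; congr (_ + _).
    exact: fejer_conv_sum.
  have jM : (0 < j < vbase m N)%N by rewrite j0 ltn_ord.
  have jr : 0 < j%:R :> R by rewrite ltr0n.
  have h1 := normc_fejer_conv_bounded m_ge2 x0 m_le x (th0 0%N) jM
    (fun y => normc_stopped_le m_ge2 c N y (th0 0%N)).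
  have h2 : `|\sum_(k < K) fejer_conv x0 N j (atom_sum c (th k) (th k.+1) N) x|c <= j%:R * bad x.
    apply: le_trans (normc_sum _ _ _) _; rewrite mulr_sumr; apply: ler_sum => k _.
    apply: le_trans (normc_fejer_conv_atom m_ge2 _ (th0 k) (th_le k) m_le _ _ jM) _.
    rewrite mulr_sumr; apply: ler_sum => n _; rewrite -/(piece k n x).
    rewrite le_eqVlt; apply/orP; left; apply/eqP.
    by rewrite sE /C1 /th exprS; ring.
  move/lt_le_trans => /(_ _ (le_trans (le_normcD _ _) (lerD h1 h2))).
  have -> : th 0%N * (30 * b ^+ 3) * j%:R = j%:R * (s / 5).
    by rewrite /th expr0 sE /C1; field.
  rewrite -mulrDr mulrC ltr_pM2l// /s; have := s0; rewrite /s; lra.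
pose p k n := avg (iota 0 N) (fun x => (stopping c (th k) n x)%:R : R) x0.
have step2 : avg (iota 0 N) (fun x => Num.min (bad x) s) x0 <=
    \sum_(k < K) \sum_(n < N.+1) 98 * b * s * 2 ^+ k * p k n.
  (* Truncating [s * 4 ^+ k * majV] at [s] amounts to truncating [majV] at [4 ^- k], the square of
     [u = 2 ^- k]. *)
  pose Q k n t : R := s * 4 ^+ k * Num.min (majV R n.-1 t) ((2 ^- k) ^+ 2).
  apply: (@le_trans _ _ (avg (iota 0 N) (fun x => \sum_(k < K) \sum_(n < N.+1)
    M n.-1 * avg (iota 0 n.-1) (fun t => (stopping c (th k) n (vadd x t))%:R * Q k n t) x0) x0)).
    apply: ler_avg => x.
    apply: le_trans (min_sum_le _ (ltW s0) _) _ => [k _|].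
      by apply: sumr_ge0 => n _; rewrite mulr_ge0// mulr_ge0 ?(ltW s0)// exprn_ge0.
    apply: ler_sum => k _.
    apply: le_trans (min_sum_le _ (ltW s0) _) _ => [n _|].
      by rewrite mulr_ge0// mulr_ge0 ?(ltW s0)// exprn_ge0.
    apply: ler_sum => n _.
    have a0 : 0 <= s * 4 ^+ k by rewrite mulr_ge0 ?(ltW s0)// exprn_ge0.
    rewrite /piece -(vbase_prod_iota R m n.-1).
    apply: le_trans (min_avg_le m_ge2 _ x0 a0 (ltW s0) _) _ => [t|].
      by rewrite mulr_ge0 ?majV_ge0.
    rewrite le_eqVlt; apply/orP; left; apply/eqP; congr (_ * _); apply: eq_avg => t.
    rewrite /Q; case: (stopping _ _ _ _); last by rewrite !mul0r mulr0 min_l// ltW.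
    rewrite !mul1r -[X in Num.min _ X]mulr1 minr_pMr//; last first.
    congr (Num.min _ _); rewrite mulr1 -mulrA -[LHS]mulr1; congr (_ * _).
    by rewrite -exprVn -exprM mulnC exprM -exprMn (_ : 4 * 2^-1 ^+ 2 = 1) ?expr1n//; field.
  rewrite avg_sum; apply: ler_sum => k _; rewrite avg_sum; apply: ler_sum => n _.
  have nN : (n <= N)%N by rewrite -ltnS.
  rewrite avgZ exchange_avg.
  have lst : level N (fun y => (stopping c (th k) n y)%:R : R).
    move=> y z /(level_le (leq_trans (leq_pred _) nN) (@level_stopping _ _ m_ge2 c (th k) n)).
    exact: (congr1 (fun e : bool => e%:R)).
  rewrite (avg_conv (iota 0 n.-1) (Q k n) x0 x0 lst) -/(p k n) {lst}.
  rewrite (avgZ (iota 0 n.-1) (s * 4 ^+ k)).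
  have := @avg_min_majV R m m_ge2 B m_le n.-1 (2 ^- k) x0.
  rewrite invr_gt0 exprn_gt0// => /(_ isT) h.
  have p0 : 0 <= p k n by apply: avg_ge0.
  rewrite (_ : M n.-1 * (p k n * (s * 4 ^+ k * _)) = p k n * (s * 4 ^+ k) * (M n.-1 *
    avg (iota 0 n.-1) (fun t => Num.min (majV R n.-1 t) ((2 ^- k) ^+ 2)) x0)); last by ring.
  have -> : 98 * b * s * 2 ^+ k * p k n = p k n * (s * 4 ^+ k) * (98 * b * 2 ^- k).
    rewrite (_ : 4 ^+ k = 2 ^+ k * 2 ^+ k); last by rewrite -exprMn; congr (_ ^+ _); ring.
    by field; rewrite expf_neq0.
  apply: ler_wpM2l; first by rewrite mulr_ge0// mulr_ge0 ?(ltW s0)// exprn_ge0.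
  by rewrite mulrC -ler_pdivlMr// vbase_real_gt0.
(* For fixed [k] the stopping events of different orders are disjoint, and [avg_stopping_le] moves
   each of them, at the cost of [b], into the set where [phi] exceeds [th k]. *)
have step3 k : \sum_(n < N.+1) p k n <=
    b * avg (iota 0 N) (fun x => (th k < phi x)%R%:R) x0.
  apply: (@le_trans _ _ (\sum_(n < N.+1) b * avg (iota 0 N) (fun x =>
      (stopping c (th k) n x)%:R * (th k < phi x)%R%:R) x0)).
    apply: ler_sum => n _; have nN : (n <= N)%N by rewrite -ltnS.
    apply: le_trans (avg_stopping_le _ _ nN) _; rewrite ler_pM2l//; apply: ler_avg => x.
    rewrite ler_wpM2l// ler_nat; case: ltP => //= h.
    by rewrite (lt_le_trans h)// phi_ge.
  rewrite -mulr_sumr ler_pM2l// -avg_sum; apply: ler_avg => x.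
  rewrite -mulr_suml -natr_sum ler_piMl// lern1.
  by rewrite -[leqRHS](sum_stopping c (th k) N.+1 x) leq_addr.
(* Markov's inequality for the truncated sum: truncation at [s] loses nothing on the event
   [s < bad x]. *)
apply: (@le_trans _ _ (s^-1 * avg (iota 0 N) (fun x => Num.min (bad x) s) x0)).
  rewrite -avgZ; apply: ler_avg => x; case: existsP => [/existsP/step1 h|_].
    by rewrite (min_r (ltW h)) mulVf// gt_eqF.
  rewrite mulr_ge0 ?invr_ge0 ?(ltW s0)// le_min (ltW s0) andbT.
  apply: sumr_ge0 => k _; apply: sumr_ge0 => n _.
  by rewrite mulr_ge0// mulr_ge0 ?(ltW s0)// exprn_ge0.
rewrite mulrC ler_pdivrMr//; apply: le_trans step2 _.
have phi0 x : 0 <= phi x by apply: le_trans (normc_ge0 _) (phi_ge 0%N x _).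
apply: (@le_trans _ _ (\sum_(k < K) 98 * b ^+ 2 * s * (2 ^+ k *
    avg (iota 0 N) (fun x => (th k < phi x)%R%:R) x0))).
  apply: ler_sum => k _; rewrite -mulr_sumr.
  rewrite (_ : 98 * b ^+ 2 * s * _ = 98 * b * s * 2 ^+ k *
    (b * avg (iota 0 N) (fun x => (th k < phi x)%R%:R) x0)); last by ring.
  apply: ler_wpM2l (step3 k).
  by rewrite mulr_ge0 ?exprn_ge0// mulr_ge0 ?(ltW s0)// mulr_ge0// ltW.
rewrite -mulr_sumr.
have -> : \sum_(k < K) 2 ^+ k * avg (iota 0 N) (fun x => (th k < phi x)%R%:R) x0 =
  avg (iota 0 N) (fun x => \sum_(k < K) 2 ^+ k * (th k < phi x)%R%:R) x0 :> R.
  rewrite (avg_sum _ _ _ (fun (k : 'I_K) x => 2 ^+ k * (th k < phi x)%R%:R)).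
  by apply: eq_bigr => k _; rewrite (avgZ _ (2 ^+ k)).
(* As [1 / eps = 300 * b ^+ 3 / lam], the condition [th k < phi x] says that [2 ^+ k] is below the
   square root of [phi x / eps]. *)
have h : avg (iota 0 N) (fun x => \sum_(k < K) 2 ^+ k * (th k < phi x)%R%:R) x0 <=
    avg (iota 0 N) (fun x => 2 * (Num.sqrt (300 * b ^+ 3 / lam) * Num.sqrt (phi x))) x0.
  apply: ler_avg => x; rewrite -sqrtrM; last first.
    by apply: divr_ge0 (ltW lam0); apply: mulr_ge0 (ler0n _ _) (exprn_ge0 _ _).
  apply: le_trans (sum_pow2_lt K (sqrtr_ge0 _)); apply: ler_sum => k _.
  rewrite ler_wpM2l ?exprn_ge0// ler_nat; case: ltP => //= kphi.
  suff -> : 2 ^+ k < Num.sqrt (300 * b ^+ 3 / lam * phi x) by [].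
  have p2 : 0 <= 2 ^+ k :> R by rewrite exprn_ge0.
  rewrite -[ltLHS](ger0_norm p2) -sqrtr_sqr ltr_sqrt.
    rewrite -exprM mulnC exprM (_ : 2 ^+ 2 = 4); last by ring.
    move: kphi; rewrite /th mulrC -ltr_pdivlMr// => /lt_le_trans; apply.
    by rewrite le_eqVlt; apply/orP; left; apply/eqP; rewrite /eps /C1; field; rewrite !gt_eqF.
  apply: mulr_gt0; last exact: le_lt_trans kphi.
  by apply: divr_gt0 lam0; apply: mulr_gt0 (ltr0Sn _ _) (exprn_gt0 _ b_gt0).
apply: le_trans (ler_wpM2l _ h) _.
  by rewrite mulr_ge0 ?(ltW s0)// mulr_ge0 ?exprn_ge0.
rewrite (avgZ _ 2 (fun x => Num.sqrt (300 * b ^+ 3 / lam) * Num.sqrt (phi x))).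
rewrite (avgZ _ _ (fun x => Num.sqrt (phi x))) le_eqVlt; apply/orP; left; apply/eqP; ring.
Qed.

End weak_type_level.

(** * Haar measure and integrals *)

Section measurability.
Variable m : nat -> nat.
Hypothesis m_ge2 : forall k, (2 <= m k)%N.
Variable B : nat.
Hypothesis m_le : forall k, (m k <= B)%N.
Local Notation G := (vilenkin m).
Implicit Types (x y z : G) (k n N : nat).

Lemma vadd_continuous (a : G) : continuous (vadd a).
Proof.
move=> x; apply/cvg_sup; first exact/fmap_filter/(nbhs_filter (x : G)).
move=> i; apply: continuous_comp_initial x => x.
apply: (@continuous_comp _ _ _ (fun z : G => z i)
  (fun t : discrete_topology 'Z_(m i) => (a i : 'Z_(m i)) + t : discrete_topology 'Z_(m i))).
  exact: (@proj_continuous nat (fun k => discrete_topology 'Z_(m k)) i).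
move=> A /nbhs_singleton At; apply: (@filterS _ (nbhs (x i : discrete_topology 'Z_(m i))) _ [set x i]).
  by move=> _ ->.
by rewrite nbhs_principalE; exact/principal_filterP.
Qed.

Lemma measurable_vadd (a : G) : measurable_fun setT (vadd a).
Proof.
apply: (@measurability _ _ _ _ _ _ (@open G)); first by [].
move=> _ [U oU <-].
rewrite setTI; apply: sub_gen_smallest.
by apply: open_comp => // x _; exact: vadd_continuous.
Qed.

Lemma open_vcylinder n x : open (vcylinder n x).
Proof.
elim: n => [|n IH].
  by rewrite (_ : vcylinder 0 x = setT) ?predeqE//; exact: openT.
have -> : vcylinder n.+1 x = vcylinder n x `&` (fun z : G => z n) @^-1` [set x n].
  apply/seteqP; split => [y yx|y [yx yn] k].
    by split; [move=> k kn; apply: yx; exact: ltnW|exact: yx].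
  by rewrite ltnS leq_eqVlt => /orP[/eqP ->|/yx].
apply: openI => //; apply: open_comp; last exact: discrete_open.
by move=> y _; exact: (@proj_continuous nat (fun k => discrete_topology 'Z_(m k)) n).
Qed.

Lemma finite_vcylinders n : finite_set (@vcylinders m n).
Proof.
pose cyl (u : {ffun 'I_n -> 'I_B.+1}) : set G :=
  [set y | forall k : 'I_n, vcoord y k = u k :> nat].
apply: (sub_finite_set (B := range cyl)); last exact: finite_image.
move=> _ [x _ <-]; exists [ffun k : 'I_n => inord (vcoord x k)] => //.
have E y (k : 'I_n) : (inord (vcoord y k) : 'I_B.+1) = vcoord y k :> nat.
  apply: inordK; apply: leq_trans (vcoord_lt m_ge2 _ _) _.
  exact: leqW (m_le k).
apply/seteqP; split => y /= yx.
  by move=> k kn; apply/val_inj; have := yx (Ordinal kn); rewrite ffunE E.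
by move=> k; rewrite ffunE E yx.
Qed.

(** Since there are finitely many cylinders of each order, this gives measurability both for the
    filtration and for the Borel sets. *)
Lemma level_preimage_bigcup {T} n (g : G -> T) (Y : set T) : level n g ->
  g @^-1` Y = \bigcup_(A in [set A | @vcylinders m n A /\ A `<=` g @^-1` Y]) A.
Proof.
move=> lg; apply/seteqP; split => [x Yx|x [A [_ AY] Ax]]; last exact: AY.
exists (vcylinder n x) => //; split; first by exists x.
by move=> y yx; rewrite /preimage /= (lg y x).
Qed.

Lemma level_measurable_gen {T} n (g : G -> T) (Y : set T) : level n g ->
  @measurable _ (g_sigma_algebraType (@vcylinders m n)) (g @^-1` Y).
Proof.
move=> lg; rewrite (level_preimage_bigcup _ lg).
apply: (@fin_bigcup_measurable _ (g_sigma_algebraType (@vcylinders m n))).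
  by apply: sub_finite_set (finite_vcylinders n) => A [].
by move=> A [cA _]; exact: sub_gen_smallest.
Qed.

Lemma level_measurable {T} n (g : G -> T) (Y : set T) : level n g ->
  measurable (g @^-1` Y : set G).
Proof.
move=> lg; rewrite (level_preimage_bigcup _ lg).
apply: fin_bigcup_measurable.
  by apply: sub_finite_set (finite_vcylinders n) => A [].
by move=> A [[x _ <-] _]; apply: sub_gen_smallest; exact: open_vcylinder.
Qed.

End measurability.

Section integrals.
Variable R : realType.
Variable m : nat -> nat.
Hypothesis m_ge2 : forall k, (2 <= m k)%N.
Variable B : nat.
Hypothesis m_le : forall k, (m k <= B)%N.
Local Notation G := (vilenkin m).
Variable mu : probability G R.
Hypothesis mu_haar : haar mu.
Implicit Types (x y z : G) (k n N : nat) (g : G -> R).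

(** The right-hand side is the sum of [g] over all shifts of [x] in the coordinates of [l], the zero
    shift being one of them. *)
Lemma le_prod_avg (l : seq nat) g x : (forall y, 0 <= g y) ->
  g x <= (\prod_(k <- l) (m k)%:R) * avg l g x.
Proof.
move=> g0; elim: l x => [|k l IH] x; first by rewrite big_nil mul1r.
have mk0 : (m k)%:R != 0 :> R by rewrite pnatr_eq0 -lt0n (leq_trans _ (m_ge2 k)).
have -> : (\prod_(j <- k :: l) (m j)%:R) * avg (k :: l) g x =
    \sum_(i < m k) (\prod_(j <- l) (m j)%:R) * avg l g (vadd (vunit m k i) x).
  rewrite big_cons avg_cons /avg1 mulr_sumr.
  by rewrite mulr_sumr; apply: eq_bigr => i _; field.
have mk : (0 < m k)%N by rewrite (leq_trans _ (m_ge2 k)).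
rewrite (bigD1 (Ordinal mk))//= vunit0; apply: le_trans (IH x) _.
by rewrite lerDl sumr_ge0// => i _; rewrite mulr_ge0 ?avg_ge0 ?prodr_ge0.
Qed.

Lemma level_bounded N g : level N g -> exists S, forall x, `|g x| <= S.
Proof.
move=> lg; pose h x := `|g x|; have lh : level N h by move=> x y xy; rewrite /h (lg x y).
exists (\prod_(k <- iota 0 N) (m k)%:R * avg (iota 0 N) h (point : G)) => x.
by rewrite (avg_iota0_cst m_ge2 _ x lh); exact: (le_prod_avg (iota 0 N) x (fun y => normr_ge0 (g y))).
Qed.

Lemma level_measurable_fun N g : level N g -> measurable_fun setT g.
Proof. by move=> lg _ Y _; rewrite setTI; exact: level_measurable lg. Qed.

Lemma level_integrable N g : level N g -> mu.-integrable setT (EFin \o g).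
Proof.
move=> lg; have [S hS] := level_bounded lg.
apply: measurable_bounded_integrable => //.
- by rewrite (le_lt_trans (probability_le1 mu measurableT))// ltry.
- exact: level_measurable_fun lg.
- exists S; split; first exact: num_real.
  by move=> M SM x _; exact: le_trans (hS x) (ltW SM).
Qed.

(** [haar] is about images; the preimage under a translation is the image under the opposite one. *)
Lemma haar_preimage (a : G) (A : set G) : measurable A -> mu (vadd a @^-1` A) = mu A.
Proof.
move=> mA; pose na : G := fun k => - vcoord a k.
have aK x : vadd a (vadd na x) = x.
  by apply: vilenkin_ext => k; rewrite !vcoord_vadd /na /vcoord addrA subrr add0r.
rewrite -(mu_haar na mA); congr (mu _); apply/seteqP; split => [x Ax|_ [y Ay <-]].
  by exists (vadd a x) => //; rewrite vaddCA aK.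
by rewrite /preimage /= aK.
Qed.

Lemma integral_vadd N g (a : G) : level N g ->
  (\int[mu]_x (g (vadd a x))%:E = \int[mu]_x (g x)%:E)%E.
Proof.
move=> lg; have lga := level_vadd a lg.
have := @integral_pushforward _ _ G G R (vadd a) (measurable_vadd a) mu setT (EFin \o g).
rewrite preimage_setT => <- //.
- by apply: eq_measure_integral => [|? A mA _]; [exact: measurable_vadd|exact: haar_preimage].
- by apply/measurable_EFinP; exact: level_measurable_fun lg.
- exact: level_integrable lga.
Qed.

(** Averaging over a coordinate preserves the integral by translation invariance, and after the
    first [N] coordinates a constant is left, integrated against a probability. *)
Lemma integral_level N g x0 : level N g ->
  (\int[mu]_x (g x)%:E = (avg (iota 0 N) g x0)%:E)%E.
Proof.
move=> lg; have step s h : level N h -> (\int[mu]_x (avg s h x)%:E = \int[mu]_x (h x)%:E)%E.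
  elim: s => // k s IH lh; rewrite -[RHS]IH//.
  have {IH} lh' : level N (avg s h) by exact: level_avg.
  rewrite avg_cons; move: (avg s h) lh' => {lh}h1 lh.
  have mk0 : (m k)%:R != 0 :> R by rewrite pnatr_eq0 -lt0n (leq_trans _ (m_ge2 k)).
  pose F (i : 'I_(m k)) x := h1 (vadd (vunit m k i) x).
  have iF i : mu.-integrable setT (EFin \o F i).
    exact: level_integrable (level_vadd _ lh).
  rewrite /avg1; under eq_integral do rewrite EFinM.
  rewrite integralZl//; last first.
    have lS : level N (fun x => \sum_(i < m k) h1 (vadd (vunit m k i) x)).
      by apply: level_sum => i _; exact: level_vadd.
    exact: level_integrable lS.
  under eq_integral do rewrite -sumEFin.
  rewrite integral_sum//.
  under eq_bigr do rewrite (integral_vadd _ lh).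
  have fin : (\int[mu]_x (h1 x)%:E)%E \is a fin_num.
    by apply: integrable_fin_num => //; exact: level_integrable lh.
  rewrite -(fineK fin) sumEFin sumr_const card_ord -EFinM; congr EFin.
  by rewrite -[fine _ *+ _]mulr_natl mulrA mulVf ?mul1r.
rewrite -(step (iota 0 N) _ lg) (eq_integral (cst (avg (iota 0 N) g x0)%:E)); last first.
  by move=> x _; rewrite /cst (avg_iota0_cst m_ge2 x x0 lg).
by rewrite (integral_cst mu measurableT) [X in (_ * X)%E]probability_setT mule1.
Qed.

Lemma probability_level N (P : G -> bool) x0 : level N P ->
  mu [set x | P x] = (avg (iota 0 N) (fun x => (P x)%:R) x0)%:E.
Proof.
move=> lP; have lPr : level N (fun x => (P x)%:R : R) by move=> x y /lP ->.
rewrite -(integral_level x0 lPr).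
have mP : measurable ([set x | P x] : set G).
  exact: (level_measurable m_ge2 m_le [set e | is_true e] lP).
rewrite -(setIT [set x | P x]) -integral_indic//; apply: eq_integral => x _.
rewrite indicE; congr (_%:E); congr (_%:R).
by case: (boolP (P x)) => Px; [rewrite mem_set|rewrite memNset//; apply/negP].
Qed.

Lemma fourier_level N (f : G -> R[i]) n x0 : level N f -> (n < vbase m N)%N ->
  fourier mu f n = avg (iota 0 N) (fun x => f x * conjc (vilenkin_fun n x)) x0.
Proof.
move=> lf nN; rewrite /fourier /cintegral.
pose h x := f x * conjc (vilenkin_fun n x).
have lh : level N h.
  by move=> x y xy; rewrite /h (lf x y)// (level_vilenkin_fun R m_ge2 nN xy).
have avgRe s x : complex.Re (avg s h x) = avg s (fun y => complex.Re (h y)) x.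
  elim: s x => // k s IH x; rewrite !avg_cons /avg1.
  have ReZ (r : R) (z : R[i]) : complex.Re ((r%:C)%C * z) = r * complex.Re z.
    by case: z => u v /=; rewrite mul0r subr0.
  rewrite -(rmorph_nat (@real_complex R)) -fmorphV ReZ raddf_sum.
  by congr (_ * _); apply: eq_bigr => i _; exact: IH.
have avgIm s x : complex.Im (avg s h x) = avg s (fun y => complex.Im (h y)) x.
  elim: s x => // k s IH x; rewrite !avg_cons /avg1.
  have ImZ (r : R) (z : R[i]) : complex.Im ((r%:C)%C * z) = r * complex.Im z.
    by case: z => u v /=; rewrite mul0r addr0.
  rewrite -(rmorph_nat (@real_complex R)) -fmorphV ImZ raddf_sum.
  by congr (_ * _); apply: eq_bigr => i _; exact: IH.
rewrite /Rintegral.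
rewrite (@integral_level N (fun x => complex.Re (h x)) x0); last by move=> x y xy; rewrite (lh x y).
rewrite (@integral_level N (fun x => complex.Im (h x)) x0); last by move=> x y xy; rewrite (lh x y).
by rewrite /= -avgRe -avgIm; case: (avg _ _ _).
Qed.

End integrals.

(** * Boundedness of the maximal operator *)

Section martingales.
Variable R : realType.
Variable m : nat -> nat.
Hypothesis m_ge2 : forall k, (2 <= m k)%N.
Variable B : nat.
Hypothesis m_le : forall k, (m k <= B)%N.
Local Notation G := (vilenkin m).
Local Notation C := R[i].
Local Notation b := (B%:R : R).
Local Notation "`| z |c" := (Normc.normc z) (format "`| z |c").
Variable mu : probability G R.
Hypothesis mu_haar : haar mu.
Implicit Types (x y z : G) (i j k n N : nat) (F : nat -> G -> C) (c : nat -> C).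

Lemma fourier_mart c n i : (i < vbase m n)%N -> fourier mu (mart c n) i = c i.
Proof.
move=> iN.
rewrite (fourier_level m_ge2 m_le mu_haar point (level_mart m_ge2 c (n := n)) iN).
transitivity (avg (iota 0 n) (fun x => \sum_(l < vbase m n)
    c l * (vilenkin_fun l x * conjc (vilenkin_fun i x))) point).
  by apply: eq_avg => x; rewrite /mart /partial_sum mulr_suml; apply: eq_bigr => l _; rewrite mulrA.
rewrite avg_sum (bigD1 (Ordinal iN))//= avgZ vilenkin_fun_orthonormal// eqxx mulr1.
rewrite big1 ?addr0// => l li; rewrite avgZ vilenkin_fun_orthonormal//.
by rewrite (_ : (l == i :> nat) = false) ?mulr0//; apply/negbTE.
Qed.

(** The martingale property fixes the coefficient from order [n] on, so the limit is that of an
    eventually constant sequence. *)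
Lemma martingale_fourierE F n i : martingale mu F -> (i < vbase m n)%N ->
  martingale_fourier mu F i = fourier mu (F n) i.
Proof.
move=> [_ _ mF] iN.
have FE l : (n <= l)%N -> fourier mu (F l) i = fourier mu (F n) i.
  move=> nl; have -> : F n = mart (fourier mu (F l)) n by apply/funext => x; rewrite -(mF n l).
  by rewrite fourier_mart.
apply: (@lim_near_cst C^o); first exact: norm_hausdorff.
by exists n => // l /= nl; exact: FE.
Qed.

Lemma martingaleE F n : martingale mu F -> F n = mart (martingale_fourier mu F) n.
Proof.
move=> mF; have [_ _ FE] := mF; apply/funext => x; rewrite -(FE n n (leqnn n)).
by apply: eq_bigr => k _; rewrite (martingale_fourierE mF (ltn_ord k)).
Qed.

Lemma mart_martingale c : martingale mu (mart c).
Proof.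
split=> [n|n|n l nl x].
- have ln := level_mart m_ge2 c (n := n).
  split; [apply: (@level_integrable _ _ m_ge2 _ m_le mu n)|apply: (@level_integrable _ _ m_ge2 _ m_le mu n)].
  + by move=> x y xy; rewrite (ln x y).
  + by move=> x y xy; rewrite (ln x y).
- have ln := level_mart m_ge2 c (n := n).
  by split; move=> _ Y _; rewrite setTI; apply: (level_measurable_gen m_ge2 m_le) => x y xy;
    rewrite (ln x y).
- apply: eq_bigr => k _; rewrite fourier_mart//.
  by apply: leq_trans (ltn_ord k) _; exact: leq_vbase.
Qed.

Lemma mart_martingale_fourier c i : martingale_fourier mu (mart c) i = c i.
Proof.
by rewrite (@martingale_fourierE _ i _ (mart_martingale c)) ?fourier_mart// vbase_gt.
Qed.

Lemma measurable_normc_mart c n : measurable_fun setT (fun x : G => (`|mart c n x|c)%:E : \bar R).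
Proof.
have ln := level_mart m_ge2 c (n := n).
apply/measurable_EFinP.
by apply: (level_measurable_fun m_ge2 m_le (N := n)) => x y xy; rewrite (ln x y).
Qed.

Lemma measurable_maximal_fun c : measurable_fun (setT : set G) (maximal_fun (mart c : nat -> G -> C)).
Proof.
have -> : maximal_fun (mart c) = fun x : G => esups (fun n => (`|mart c n x|c)%:E : \bar R) 0%N.
  apply/funext => x; rewrite /maximal_fun /esups /sdrop /=; congr ereal_sup.
  by apply/seteqP; split => _ [n _ <-]; exists n.
by apply: measurable_fun_esups => n; exact: measurable_normc_mart.
Qed.

Lemma maximal_fun_ge0 F x : (0 <= maximal_fun F x)%E.
Proof.
apply: (@le_trans _ _ (Normc.normc (F 0%N x))%:E); first by rewrite lee_fin normc_ge0.
by apply: ereal_sup_ubound; exists 0%N.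
Qed.

(** * Reduction of the [T] means to Fejer sums *)

Section T_means.
Variable q : nat -> R.
Hypothesis q_ge0 : forall k, 0 <= q k.
Hypothesis q_noninc : nonincreasing_seq q.
Hypothesis q0_gt0 : 0 < q 0%N.

Lemma abel_sum (K : comRingType) (u s : nat -> K) n :
  \sum_(k < n) u k * s k =
  \sum_(k < n) (u k - u k.+1) * (\sum_(l < k.+1) s l) + u n * \sum_(l < n) s l.
Proof.
elim: n => [|n IH]; first by rewrite !big_ord0 mulr0 addr0.
by rewrite big_ord_recr [in RHS]big_ord_recr /= IH [\sum_(l < n.+1) s l]big_ord_recr /=; ring.
Qed.

Lemma Tweight_gt0 n : (0 < n)%N -> 0 < Tweight q n.
Proof. by case: n => // n _; rewrite /Tweight big_ord_recl ltr_pwDl// sumr_ge0. Qed.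

(** If every sum of [j] partial sums were at most [lam * j], Abel summation, whose coefficients are
    nonnegative, would bound the mean by [lam]: the same summation applied to the constant 1
    evaluates exactly to [Tweight q n]. *)
Lemma normc_Tmean_gt (lam : R) F n x : 0 <= lam -> (0 < n)%N -> lam < `|Tmean mu q F n x|c ->
  exists2 j, (0 < j <= n)%N &
    lam * j%:R < `|\sum_(k < j) partial_sum (martingale_fourier mu F) k x|c.
Proof.
move=> lam0 n0; set c := martingale_fourier mu F => lamT.
pose A j := \sum_(k < j) partial_sum c k x.
have [//|noj] := pselect (exists2 j, (0 < j <= n)%N & lam * j%:R < `|A j|c).
have Aj j : (j <= n)%N -> `|A j|c <= lam * j%:R.
  case: j => [|j] jn; first by rewrite /A big_ord0 Normc.normc0 mulr0.
  by rewrite leNgt; apply/negP => h; apply: noj; exists j.+1.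
have Q0 := Tweight_gt0 n0.
have : `|Tmean mu q F n x|c <= lam.
  rewrite /Tmean Normc.normcM normc_real gtr0_norm ?invr_gt0// mulrC ler_pdivrMr//.
  rewrite (abel_sum (fun k => (q k)%:C%C) (fun k => partial_sum c k x)).
  have -> : lam * Tweight q n = \sum_(k < n) (q k - q k.+1) * (lam * k.+1%:R) + q n * (lam * n%:R).
    rewrite /Tweight (eq_bigr (fun k : 'I_n => q k * 1)); last by move=> k _; rewrite mulr1.
    rewrite (abel_sum q (fun=> 1)) mulrDr mulr_sumr; congr (_ + _); last first.
      by rewrite sumr_const card_ord; ring.
    by apply: eq_bigr => k _; rewrite sumr_const card_ord; ring.
  apply: le_trans (le_normcD _ _) _; apply: lerD.
    apply: le_trans (normc_sum _ _ _) _; apply: ler_sum => k _.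
    have qk : 0 <= q k - q k.+1 by rewrite subr_ge0 q_noninc.
    rewrite Normc.normcM -rmorphB normc_real ger0_norm// ler_wpM2l//.
    exact: Aj.
  by rewrite Normc.normcM normc_real ger0_norm// ler_wpM2l// Aj.
by rewrite leNgt lamT.
Qed.

Lemma level_Tmean F n N : (n <= vbase m N)%N -> level N (Tmean mu q F n).
Proof.
move=> nN x y xy; set c := martingale_fourier mu F.
have E (k : 'I_n) : partial_sum c k x = partial_sum c k y.
  have kN : (k <= vbase m N)%N by apply: leq_trans (ltnW (ltn_ord k)) nN.
  exact: (level_partial_sum m_ge2 c kN xy).
exact (congr1 (fun w : C => ((Tweight q n)^-1)%:C%C * w)
  (eq_bigr _ (fun (k : 'I_n) _ => congr1 (fun w : C => (q k)%:C%C * w) (E k)))).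
Qed.

Let Kc := 196 * b ^+ 2.

(** The set is covered by the increasing events [P N], in which only orders below [vbase m N]
    compete. Each of these depends on finitely many coordinates, so [weak_type_level] applies, and
    continuity of the measure passes to the union. *)
Lemma measure_Tmaximal_le F (lam : R) : 0 < lam -> martingale mu F ->
  (mu [set x | lam%:E < `|Tmaximal mu q F x|] <=
   (Kc * Num.sqrt (300 * b ^+ 3 / lam))%:E * \int[mu]_x (`|maximal_fun F x| `^ 2^-1))%E.
Proof.
move=> lam0 mF; set c := martingale_fourier mu F.
have FE : F = mart c by apply/funext => n; exact: martingaleE.
set I := (\int[mu]_x _)%E.
pose P N x : bool := [exists j : 'I_(vbase m N),
     (0 < j)%N && (lam * j%:R < `|\sum_(k < j) partial_sum c k x|c)%R].
have lP N : level N (P N).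
  move=> x y xy; apply: eq_existsb => j.
  have E (k : 'I_j) : partial_sum c k x = partial_sum c k y.
    have kN : (k <= vbase m N)%N by exact: leq_trans (ltnW (ltn_ord k)) (ltnW (ltn_ord j)).
    exact: (level_partial_sum m_ge2 c kN xy).
  exact (congr1 (fun z : C => (0 < j)%N && (lam * j%:R < `|z|c)%R) (eq_bigr _ (fun (k : 'I_j) _ => E k))).
have mP N : measurable ([set x | P N x] : set G).
  exact: (level_measurable m_ge2 m_le [set e | is_true e] (lP N)).
have T0 x : (0 <= Tmaximal mu q F x)%E.
  apply: (@le_trans _ _ (Tmean_abs mu q F 1 x)); first by rewrite lee_fin normc_ge0.
  by apply: ereal_sup_ubound; exists 1%N.
have mT : measurable ([set x | (lam%:E < `|Tmaximal mu q F x|)%E] : set G).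
  rewrite (_ : mkset _ = \bigcup_n [set x | (0 < n)%N && (lam < `|Tmean mu q F n x|c)%R]).
    apply: bigcup_measurable => n _.
    have lT := level_Tmean F (ltnW (vbase_gt m_ge2 n)).
    exact: (level_measurable m_ge2 m_le [set z | (0 < n)%N && (lam < `|z|c)%R] lT).
  apply/seteqP; split => x /=.
    rewrite gee0_abs; last exact: T0.
    by move=> /ereal_sup_gt[_ [n /= n0 <-]]; rewrite lte_fin => h; exists n => //=; rewrite n0.
  move=> [n _ /= /andP[n0 h]]; apply: (@lt_le_trans _ _ (Tmean_abs mu q F n x)).
    by rewrite lte_fin.
  by apply: le_trans (lee_abs _); apply: ereal_sup_ubound; exists n.
apply: (@le_trans _ _ (mu (\bigcup_N [set x | P N x]))).
  apply: le_measure; rewrite ?inE//; first exact: bigcup_measurable.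
  move=> x /=; rewrite gee0_abs; last exact: T0.
  move=> /ereal_sup_gt[_ [n /= n0 <-]]; rewrite lte_fin.
  move=> /(normc_Tmean_gt (ltW lam0) n0)[j /andP[j0 jn] h]; exists n => //=.
  have jM : (j < vbase m n)%N by rewrite (leq_ltn_trans jn)// vbase_gt.
  by apply/existsP; exists (Ordinal jM); rewrite j0.
have ndP : nondecreasing_seq (fun N => [set x | P N x] : set G).
  move=> N N' NN'; apply/subsetPset => x /= /existsP[j h]; apply/existsP.
  by exists (widen_ord (leq_vbase m_ge2 NN') j).
have cvgP := @nondecreasing_cvg_mu _ _ _ mu _ mP (bigcup_measurable (fun N _ => mP N)) ndP.
rewrite -(cvg_lim _ cvgP)//; apply: lime_le; first by apply/cvg_ex; eexists; exact: cvgP.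
near=> N.
(* The maximal function cut at order [N] still has level [N], so its average is an integral. *)
pose phi x : R := \big[Num.max/0]_(n < N.+1) `|mart c n x|c.
have phi_ge n x : (n <= N)%N -> `|mart c n x|c <= phi x.
  move=> nN; rewrite /phi (bigD1 (Ordinal (nN : (n < N.+1)%N)))//= le_max lexx//.
have lphi : level N (fun x => Num.sqrt (phi x)).
  move=> x y xy; have E (n : 'I_N.+1) : mart c n x = mart c n y.
    have nN : (n <= N)%N by rewrite -ltnS.
    exact: (level_le nN (level_mart m_ge2 c (n := n)) xy).
  exact (congr1 Num.sqrt (eq_bigr _ (fun (n : 'I_N.+1) _ => congr1 (@Normc.normc R) (E n)))).
have := @weak_type_level R m m_ge2 B m_le c N lam phi point lam0 phi_ge.
rewrite -lee_fin => hw; apply: le_trans (le_trans _ hw) _.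
  by rewrite -(probability_level m_ge2 m_le mu_haar point (lP N)).
rewrite EFinM; apply: lee_wpmul2l.
  rewrite lee_fin; apply: mulr_ge0 (sqrtr_ge0 _).
  exact: mulr_ge0 (ler0n _ _) (sqr_ge0 _).
rewrite -(integral_level m_ge2 m_le mu_haar point lphi).
apply: ge0_le_integral => //.
- apply/measurable_EFinP; exact (level_measurable_fun m_ge2 m_le lphi).
- apply: (measurableT_comp (measurable_poweR _)); apply: measurableT_comp => //.
  rewrite FE; exact: measurable_maximal_fun.
- move=> x _; rewrite gee0_abs ?maximal_fun_ge0//.
  have phi0 : 0 <= phi x by exact: le_trans (normc_ge0 _) (phi_ge 0%N x _).
  rewrite -powR12_sqrt// -poweR_EFin; apply: gt0_ler_poweR; rewrite ?invr_ge0//.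
  + by rewrite in_itv /= lee_fin phi0 leey.
  + by rewrite in_itv /= maximal_fun_ge0 leey.
  rewrite /phi; elim/big_ind : _ => [|u v hu hv|n _]; first exact: maximal_fun_ge0.
    by rewrite /Num.max; case: ifP.
  by apply: ereal_sup_ubound; exists n => //; rewrite FE.
Unshelve. all: by end_near.
Qed.

(** Squaring, the exponent being [1 / p = 2], cancels [lam] and turns the integral into the Hardy
    norm. Finiteness of the norm lets the computation take place in [R]. *)
Lemma Tmaximal_weak_type F : martingale mu F -> (hardy_norm mu 2^-1 F < +oo)%E ->
  (weak_Lnorm mu 2^-1 (Tmaximal mu q F) <=
   (Kc ^+ 2 * (300 * b ^+ 3))%:E * hardy_norm mu 2^-1 F)%E.
Proof.
move=> mF; rewrite /hardy_norm unlock.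
set I := (\int[mu]_x _)%E => I2.
have I0 : (0 <= I)%E by apply: integral_ge0 => x _; exact: poweR_ge0.
have Ifin : (I < +oo)%E by apply: lty_poweRy I2; rewrite invr_neq0.
have IE : I = (fine I)%:E by rewrite fineK// ge0_fin_numE.
have r0 : 0 <= fine I by rewrite fine_ge0.
apply: ge_ereal_sup => _ [lam /= lam0 <-].
have h := measure_Tmaximal_le lam0 mF; rewrite -/I in h.
set S := mu _ in h *.
have K0 : 0 <= Kc by exact: mulr_ge0 (ler0n _ _) (sqr_ge0 _).
have b30 : 0 <= 300 * b ^+ 3 by exact: mulr_ge0 (ler0n _ _) (exprn_ge0 _ (ler0n _ _)).
have KS0 : 0 <= Kc * Num.sqrt (300 * b ^+ 3 / lam) by exact: mulr_ge0 K0 (sqrtr_ge0 _).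
have S0 : (0 <= S)%E by exact: measure_ge0.
apply: (@le_trans _ _ (lam%:E * ((Kc * Num.sqrt (300 * b ^+ 3 / lam))%:E * I) `^ (2^-1)^-1)%E).
  apply: lee_pmul; rewrite ?lee_fin ?(ltW lam0) ?poweR_ge0//.
  apply: gt0_ler_poweR; rewrite ?invrK//.
  + by rewrite in_itv /= S0 leey.
  + by rewrite in_itv /= leey andbT mule_ge0.
rewrite IE -EFinM !poweR_EFin -!EFinM lee_fin invrK.
rewrite (powR_mulrn 2 (mulr_ge0 KS0 r0)) (powR_mulrn 2 r0).
rewrite !exprMn sqr_sqrtr; last exact: divr_ge0 b30 (ltW lam0).
by rewrite le_eqVlt; apply/orP; left; apply/eqP; field; rewrite gt_eqF.
Qed.

End T_means.

End martingales.

(** * The counterexample *)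

Section power_subadditivity.
Variable R : realType.
Implicit Types a d p : R.

Lemma powR_subadditive a d p : 0 <= a -> 0 <= d -> 0 < p <= 1 ->
  (a + d) `^ p <= a `^ p + d `^ p.
Proof.
move=> a0 d0 /andP[p0 p1].
have [s0|s0] := eqVneq (a + d) 0.
  by rewrite s0 powR0 ?gt_eqF// addr_ge0// powR_ge0.
have sp : 0 < a + d by rewrite lt_neqAle eq_sym s0 addr_ge0.
have le t : 0 <= t <= 1 -> t <= t `^ p.
  move=> /andP[]; rewrite le_eqVlt => /orP[/eqP <- _|t0 t1]; first exact: powR_ge0.
  by apply: ger1_powR => //; rewrite t0.
have part t : 0 <= t -> t <= a + d -> (a + d) `^ p * (t / (a + d)) <= t `^ p.
  move=> t0 ts; have td : 0 <= t / (a + d) by rewrite divr_ge0// ltW.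
  rewrite -[t in leRHS](divfK s0) [t / _ * _]mulrC powRM ?(ltW sp)//.
  rewrite ler_wpM2l ?powR_ge0// le// td ler_pdivrMr// mul1r//.
have ha : a <= a + d by rewrite lerDl.
have hd : d <= a + d by rewrite lerDr.
have := lerD (part a a0 ha) (part d d0 hd).
by rewrite -mulrDr -mulrDl divff// mulr1.
Qed.

Lemma powR_sum_le (I : Type) (r : seq I) (P : pred I) (F : I -> R) p :
  0 < p <= 1 -> (forall i, P i -> 0 <= F i) ->
  (\sum_(i <- r | P i) F i) `^ p <= \sum_(i <- r | P i) F i `^ p.
Proof.
move=> p01 F0; have p0 : p != 0 by case/andP: p01 => p0 _; rewrite gt_eqF.
pose K (x y : R) := 0 <= x /\ x `^ p <= y.
suff [] : K (\sum_(i <- r | P i) F i) (\sum_(i <- r | P i) F i `^ p) by [].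
apply: big_ind2 => [|x1 y1 x2 y2 [x10 h1] [x20 h2]|i Pi].
- by split; rewrite ?powR0.
- split; first exact: addr_ge0.
  by apply: le_trans (powR_subadditive x10 x20 p01) _; exact: lerD.
- by split; [exact: F0|].
Qed.

End power_subadditivity.

(** * The lacunary martingale *)

Section counterexample.
Variable R : realType.
Variable m : nat -> nat.
Hypothesis m_ge2 : forall k, (2 <= m k)%N.
Variable B : nat.
Hypothesis m_le : forall k, (m k <= B)%N.
Local Notation G := (vilenkin m).
Local Notation C := R[i].
Local Notation M i := ((vbase m i)%:R : R).
Local Notation b := (B%:R : R).
Local Notation "`| z |c" := (Normc.normc z) (format "`| z |c").
Variable mu : probability G R.
Hypothesis mu_haar : haar mu.
Implicit Types (x y : G) (i j k n N : nat).
Variables (q : nat -> R) (p c0 : R).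
Hypothesis q_ge0 : forall k, 0 <= q k.
Hypothesis q0_gt0 : 0 < q 0%N.
Hypothesis p_bounds : 0 < p < 2^-1.
Hypothesis c0_gt0 : 0 < c0.
Hypothesis q_lower : forall n, (0 < n)%N -> c0 / n%:R <= q n.+1 / Tweight q n.+2.

Let p_gt0 : 0 < p. Proof. by case/andP: p_bounds. Qed.

Let p_le1 : p <= 1.
Proof. by case/andP: p_bounds => _ h; apply: ltW; apply: lt_trans h _; lra. Qed.

Let M_gt0 i : 0 < M i. Proof. exact: vbase_real_gt0. Qed.

Let b_ge1 : 1 <= b.
Proof. by rewrite ler1n (leq_trans _ (m_le 0))// (leq_trans _ (m_ge2 0)). Qed.

(* Amplitude of the k-th block when it starts at [vbase m al] and the earlier
   coefficients sum up to [P]: it makes the mean of order [vbase m al + 2] at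
   least [k] everywhere. *)
Definition amplitude k (P : R) al : R := M al / c0 * (k%:R + P).

Lemma exists_block k (P : R) a0 : 0 <= P ->
  exists al, (a0 <= al)%N /\ (amplitude k P al * M al) `^ p / M al <= 2^-1 ^+ k.
Proof.
move=> P0; pose D := (k%:R + P) / c0; have D0 : 0 <= D by rewrite divr_ge0 ?addr_ge0// ltW.
have e0 : 0 < 1 - 2 * p by case/andP: p_bounds => _ h; lra.
pose X : R := D `^ p * 2 ^+ k.
have X0 : 0 <= X by rewrite mulr_ge0 ?powR_ge0 ?exprn_ge0.
pose Y := X `^ (1 - 2 * p)^-1.
exists (maxn a0 (Num.bound `|Y|)); split; first exact: leq_maxl.
set al := maxn _ _; set a := M al; have a_gt0 : 0 < a by exact: M_gt0.
have Ya : Y <= a.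
  apply: le_trans (ler_norm _) _; apply: le_trans (ltW (archi_boundP (normr_ge0 _))) _.
  by rewrite ler_nat (leq_trans (leq_maxr a0 _))// ltnW// vbase_gt.
have Xa : X <= a `^ (1 - 2 * p).
  have -> : X = Y `^ (1 - 2 * p) by rewrite -powRrM mulVf ?gt_eqF// powRr1.
  by apply: ge0_ler_powR; rewrite ?nnegrE ?powR_ge0// ltW.
have -> : amplitude k P al * M al = D * a ^+ 2.
  by rewrite /amplitude /D -/a; field; rewrite gt_eqF.
rewrite powRM ?sqr_ge0// -(powR_mulrn _ (ltW a_gt0)) -powRrM.
have -> : D `^ p * a `^ (2 * p) / a = D `^ p / a `^ (1 - 2 * p).
  rewrite powRB ?(gt_eqF a_gt0) ?implybT// powRr1 ?(ltW a_gt0)//.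
  by field; rewrite !gt_eqF// powR_gt0.
rewrite ler_pdivrMr ?powR_gt0// exprVn mulrC -ler_pdivrMr ?invr_gt0 ?exprn_gt0//.
by rewrite invrK.
Qed.

Lemma block_choice : exists pick : nat -> R -> nat -> nat, forall k P a0, 0 <= P ->
  (a0 <= pick k P a0)%N /\
  (amplitude k P (pick k P a0) * M (pick k P a0)) `^ p / M (pick k P a0) <= 2^-1 ^+ k.
Proof.
have /choice[f hf] : forall t : nat * R * nat, exists al, 0 <= t.1.2 ->
    (t.2 <= al)%N /\ (amplitude t.1.1 t.1.2 al * M al) `^ p / M al <= 2^-1 ^+ t.1.1.
  move=> [[k P] a0] /=; have [P0|nP0] := pselect (0 <= P); last by exists 0%N.
  by have [al h] := exists_block k a0 P0; exists al.
by exists (fun k P a0 => f (k, P, a0)) => k P a0 P0; exact: (hf (k, P, a0)).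
Qed.

Lemma block_sequences : exists (al : nat -> nat) (P : nat -> R),
  [/\ forall k, (al k < al k.+1)%N, P 0%N = 0, forall k, 0 <= P k,
      forall k, P k.+1 = P k + amplitude k (P k) (al k) * (M (al k).+1 - M (al k)) &
      forall k, (amplitude k (P k) (al k) * M (al k)) `^ p / M (al k) <= 2^-1 ^+ k].
Proof.
have [pick hpick] := block_choice.
pose next (t : nat * R) k := t.2 + amplitude k t.2 t.1 * (M t.1.+1 - M t.1).
(* Indices and bounds are built together: an amplitude depends on the sum of all earlier
   coefficients, and the next index on that amplitude. *)
pose st := fix st k : nat * R := if k is j.+1 then
  let P' := next (st j) j in (pick k P' (st j).1.+1, P') else (pick 0%N 0 0%N, 0).
have P0 k : 0 <= (st k).2.
  elim: k => [//|k IH] /=; rewrite /next addr_ge0// mulr_ge0//.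
    by rewrite mulr_ge0 ?addr_ge0// divr_ge0 ?(ltW c0_gt0)// ltW.
  by rewrite subr_ge0 ler_nat leq_vbase.
have stE k : (st k).1 = pick k (st k).2 (if k is j.+1 then (st j).1.+1 else 0%N).
  by case: k.
exists (fun k => (st k).1), (fun k => (st k).2); split => // k.
- by rewrite [X in (_ < X)%N]stE; have [] := hpick k.+1 _ (st k).1.+1 (P0 k.+1).
- by rewrite stE; have [] := hpick k _ (if k is j.+1 then (st j).1.+1 else 0%N) (P0 k).
Qed.

Section blocks.
Variables (al : nat -> nat) (P : nat -> R).
Hypothesis al_incr : forall k, (al k < al k.+1)%N.
Hypothesis P0 : P 0%N = 0.
Hypothesis P_ge0 : forall k, 0 <= P k.
Local Notation u k := (amplitude k (P k) (al k)).
Hypothesis PS : forall k, P k.+1 = P k + u k * (M (al k).+1 - M (al k)).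
Hypothesis u_small : forall k, (u k * M (al k)) `^ p / M (al k) <= 2^-1 ^+ k.

Let u_ge0 k : 0 <= u k.
Proof. by rewrite mulr_ge0 ?addr_ge0// divr_ge0 ?(ltW c0_gt0)// ltW. Qed.

Let uM_ge0 k : 0 <= 2 * b * u k * M (al k).
Proof. by apply: mulr_ge0 => //; apply: mulr_ge0 => //; exact: mulr_ge0. Qed.

Let al_mono i k : (i < k)%N -> (al i < al k)%N.
Proof. exact: (homo_ltn ltn_trans al_incr). Qed.

Let al_ge k : (k <= al k)%N.
Proof. by elim: k => // k IH; exact: leq_ltn_trans IH (al_incr k). Qed.

Definition in_block k j := (vbase m (al k) <= j < vbase m (al k).+1)%N.

(** Restricting to [k <= j] loses no block containing [j], since [k <= al k < vbase m (al k)]. Up to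
    [vbase m n] a block is either entirely present or entirely absent. *)
Lemma sum_blocks (V : nmodType) (w : nat -> nat -> V) n :
  \sum_(j < vbase m n) \sum_(k < j.+1) (if in_block k j then w k j else 0) =
  \sum_(k < n) if (al k < n)%N then \sum_(vbase m (al k) <= j < vbase m (al k).+1) w k j else 0.
Proof.
have widen j : (j < vbase m n)%N ->
    \sum_(k < j.+1) (if in_block k j then w k j else 0) =
    \sum_(k < n) (if in_block k j then w k j else 0).
  move=> jn; pose F k := if in_block k j then w k j else 0.
  have ext a e : (a <= e)%N -> (forall k, (a <= k)%N -> in_block k j = false) ->
      \sum_(k < a) F k = \sum_(k < e) F k.
    move=> ae h; rewrite -!(big_mkord xpredT F) (big_cat_nat _ ae)//=.
    rewrite [X in _ = _ + X]big1_seq ?addr0// => k /=.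
    by rewrite mem_index_iota => /andP[ak _]; rewrite /F h.
  have h1 k : (j.+1 <= k)%N -> in_block k j = false.
    move=> jk; apply/negbTE; rewrite negb_and -ltnNge; apply/orP; left.
    by rewrite (leq_trans jk)// (leq_trans (al_ge k))// ltnW// vbase_gt.
  have h2 k : (n <= k)%N -> in_block k j = false.
    move=> nk; apply/negbTE; rewrite negb_and -ltnNge; apply/orP; left.
    by rewrite (leq_trans jn)// leq_vbase// (leq_trans nk).
  by rewrite -!/(F _) (ext j.+1 (maxn j.+1 n)) ?leq_maxl// (ext n (maxn j.+1 n)) ?leq_maxr.
rewrite (eq_bigr (fun j : 'I_(vbase m n) => \sum_(k < n) (if in_block k j then w k j else 0))); last first.
  by move=> j _; exact: widen.
rewrite exchange_big /=; apply: eq_bigr => k _.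
rewrite -(big_mkord xpredT (fun j => if in_block k j then w k j else 0)).
have le1 : (vbase m (al k) <= vbase m (al k).+1)%N by exact: leq_vbase.
case: ltnP => kn.
  have le2 : (vbase m (al k).+1 <= vbase m n)%N by exact: leq_vbase.
  rewrite (big_cat_nat _ (leq_trans le1 le2))//= big1_seq ?add0r => [|j]; last first.
    by rewrite mem_index_iota /= => jk; rewrite /in_block leqNgt jk.
  rewrite (big_cat_nat le1 le2)/= [X in _ + X]big1_seq ?addr0 => [|j]; last first.
    by rewrite mem_index_iota /= => /andP[jk _]; rewrite /in_block ltnNge jk andbF.
  by apply: eq_big_seq => j; rewrite mem_index_iota /in_block => ->.
rewrite big1_seq// => j /=; rewrite mem_index_iota /= => jn.
by rewrite /in_block leqNgt (leq_trans jn)// leq_vbase.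
Qed.

(* The martingale [mart block_coef] is the sum of the [H_p]-atoms
   [D_(M_(al k + 1)) - D_(M_(al k))], with coefficients [u k]. *)
Definition block_coef j : C := \sum_(k < j.+1) (if in_block k j then (u k)%:C%C else 0).

Lemma normc_block_coef j : `|block_coef j|c <= \sum_(k < j.+1) (if in_block k j then u k else 0).
Proof.
apply: le_trans (normc_sum _ _ _) _; apply: ler_sum => k _.
by case: ifP => _; rewrite ?Normc.normc0// normc_real ger0_norm.
Qed.

Lemma sum_normc_block_coef k : \sum_(j < vbase m (al k)) `|block_coef j|c <= P k.
Proof.
apply: (@le_trans _ _ (\sum_(j < vbase m (al k)) \sum_(i < j.+1) (if in_block i j then u i else 0))).
  by apply: ler_sum => j _; exact: normc_block_coef.
rewrite (sum_blocks (fun i _ => u i)).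
have PE n : P n = \sum_(i < n) u i * (M (al i).+1 - M (al i)).
  by elim: n => [|n IH]; [rewrite big_ord0|rewrite big_ord_recr /= -IH].
pose F i := if (al i < al k)%N then \sum_(vbase m (al i) <= j < vbase m (al i).+1) u i else 0.
rewrite (_ : \sum_(i < al k) _ = \sum_(i < al k) F i)//.
rewrite -(big_mkord xpredT F) (big_cat_nat _ (al_ge k))//= [X in _ + X]big1_seq ?addr0 => [|i]; last first.
  rewrite mem_index_iota /= => /andP[ki _]; rewrite /F ltnNge.
  by move: ki; rewrite leq_eqVlt => /orP[/eqP ->|/al_mono/ltnW ->//]; rewrite leqnn.
rewrite PE big_mkord; apply: ler_sum => i _; rewrite /F al_mono//.
by rewrite sumr_const_nat -natrB ?leq_vbase// mulr_natr.
Qed.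

Lemma block_coef_start k : block_coef (vbase m (al k)) = (u k)%:C%C.
Proof.
have kj : (k < (vbase m (al k)).+1)%N by rewrite (leq_ltn_trans (al_ge k))// ltnW// ltnS vbase_gt.
rewrite /block_coef (bigD1 (Ordinal kj))//= big1 ?addr0 => [|i ik].
  by rewrite /in_block leqnn vbaseS ltn_Pmulr// vbase_gt0.
rewrite ifF//; apply/negbTE/negP => /andP[h1 h2]; move: ik; rewrite -val_eqE /= neq_ltn => /orP[] /al_mono.
  by move=> /(leq_vbase m_ge2); rewrite leqNgt h2.
move=> /(leq_vbase m_ge2); apply/negP; rewrite -ltnNge (leq_ltn_trans h1)//.
by rewrite vbaseS ltn_Pmulr// vbase_gt0.
Qed.

Lemma normc_partial_sum_block j k x : (j <= vbase m (al k))%N ->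
  `|partial_sum block_coef j x|c <= P k.
Proof.
move=> jk; apply: le_trans (sum_normc_block_coef k).
rewrite -(big_mkord xpredT (fun j => `|block_coef j|c)) [leRHS](big_cat_nat _ jk)//=.
apply: le_trans (normc_sum _ _ _) _; rewrite big_mkord.
apply: (@le_trans _ _ (\sum_(i < j) `|block_coef i|c)).
  by apply: ler_sum => i _; rewrite Normc.normcM normc_vilenkin_fun// mulr1.
by rewrite lerDl sumr_ge0// => i _; exact: normc_ge0.
Qed.

(** With [a = vbase m (al k)], only the last partial sum in the mean of order [a + 2] contains the
    character of index [a]. Everything else is at most [P k] after normalization, while [q_lower] at
    [a] makes this character contribute at least [k%:R + P k]. *)
Lemma normc_Tmean_ge k x :
  k%:R <= `|Tmean mu q (mart block_coef) (vbase m (al k)).+2 x|c.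
Proof.
set a := vbase m (al k); have a0 : (0 < a)%N by exact: vbase_gt0.
have Q0 : 0 < Tweight q a.+2 by apply: Tweight_gt0.
have cE : martingale_fourier mu (mart block_coef) = block_coef.
  by apply/funext => i; rewrite (mart_martingale_fourier m_ge2 m_le mu_haar).
rewrite /Tmean cE Normc.normcM normc_real gtr0_norm ?invr_gt0// mulrC ler_pdivlMr//.
set S := \sum_(i < _) _.
pose S' : C := \sum_(i < a.+1) (q i)%:C%C * partial_sum block_coef i x
  + (q a.+1)%:C%C * partial_sum block_coef a x.
have SE : S = S' + (q a.+1)%:C%C * ((u k)%:C%C * vilenkin_fun a x).
  rewrite /S big_ord_recr /= /S' -addrA; congr (_ + _).
  by rewrite -mulrDr /partial_sum [X in _ * X = _]big_ord_recr /= block_coef_start.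
have S'le : `|S'|c <= Tweight q a.+2 * P k.
  have -> : Tweight q a.+2 = \sum_(i < a.+1) q i + q a.+1 by rewrite /Tweight big_ord_recr.
  apply: le_trans (le_normcD _ _) _; rewrite mulrDl; apply: lerD.
    apply: le_trans (normc_sum _ _ _) _; rewrite mulr_suml; apply: ler_sum => i _.
    rewrite Normc.normcM normc_real ger0_norm// ler_wpM2l// normc_partial_sum_block//.
    by rewrite -ltnS.
  by rewrite Normc.normcM normc_real ger0_norm// ler_wpM2l// normc_partial_sum_block.
have mainE : `|(q a.+1)%:C%C * ((u k)%:C%C * vilenkin_fun a x)|c = q a.+1 * u k.
  by rewrite !Normc.normcM !normc_real !ger0_norm// normc_vilenkin_fun// mulr1.
have tri : q a.+1 * u k <= `|S|c + `|S'|c.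
  rewrite -mainE (_ : (q a.+1)%:C%C * _ = S - S'); last by rewrite SE addrC addKr.
  by apply: le_trans (le_normcD _ _) _; rewrite normcN.
have big : (k%:R + P k) * Tweight q a.+2 <= q a.+1 * u k.
  have := q_lower a0; rewrite ler_pdivlMr// => h.
  have -> : (k%:R + P k) * Tweight q a.+2 = (c0 / a%:R * Tweight q a.+2) * u k.
    rewrite /amplitude -/a; field; rewrite !gt_eqF//=; exact: M_gt0.
  by rewrite ler_wpM2r.
lra.
Qed.

(** A block is a difference of two Dirichlet kernels; by Paley's formula it lives where the first
    [al k] coordinates vanish and has modulus at most [2 * b * M (al k)]. *)
Lemma normc_mart_block n x : `|mart block_coef n x|c <=
  \sum_(k < n) 2 * b * u k * M (al k) * (zeros (al k) (al k) x)%:R.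
Proof.
have -> : mart block_coef n x = \sum_(j < vbase m n) \sum_(k < j.+1)
    (if in_block k j then (u k)%:C%C * vilenkin_fun j x else 0).
  apply: eq_bigr => j _; rewrite /block_coef mulr_suml; apply: eq_bigr => k _.
  by case: ifP => _; rewrite ?mul0r.
rewrite (sum_blocks (fun k j => (u k)%:C%C * vilenkin_fun j x : C)).
apply: le_trans (normc_sum _ _ _) _; apply: ler_sum => k _.
have r0 : 0 <= 2 * b * u k * M (al k) * (zeros (al k) (al k) x)%:R.
  by apply: mulr_ge0.
case: ifP => _; last by rewrite Normc.normc0.
rewrite -mulr_sumr Normc.normcM normc_real ger0_norm//.
rewrite (_ : 2 * b * u k * _ * _ = u k * (2 * b * M (al k) * (zeros (al k) (al k) x)%:R)); last by ring.
apply: ler_wpM2l => //.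
have le1 : (vbase m (al k) <= vbase m (al k).+1)%N by exact: leq_vbase.
have -> : \sum_(vbase m (al k) <= j < vbase m (al k).+1) vilenkin_fun j x =
    dirichlet R (vbase m (al k).+1) x - dirichlet R (vbase m (al k)) x.
  rewrite /dirichlet -!(big_mkord xpredT (fun j => vilenkin_fun j x : C)).
  by rewrite (big_cat_nat (leq0n _) le1)//= [X in X - _]addrC addrK.
apply: le_trans (le_normcD _ _) _; rewrite normcN !dirichlet_vbase// !Normc.normcM !normc_nat zerosSS.
case: zeros => /=; last by rewrite !mulr0 addr0.
have mb : M (al k).+1 <= M (al k) * b by rewrite vbase_realS// ler_pM2l// ler_nat.
have Mb : M (al k) <= M (al k) * b by rewrite ler_peMr// ltW.
have M0 := M_gt0 (al k).+1.
by case: eqP => _; rewrite ?mulr1 ?mulr0; lra.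
Qed.

Let h k x : R := (2 * b * u k * M (al k)) `^ p * (zeros (al k) (al k) x)%:R.

Let h_ge0 k x : 0 <= h k x.
Proof. by rewrite mulr_ge0 ?powR_ge0. Qed.

Let level_h k : level (al k) (h k).
Proof. by move=> x y xy; rewrite /h (level_zeros _ xy). Qed.

Let integral_h k : (\int[mu]_x (h k x)%:E <= ((2 * b) `^ p * b * 2^-1 ^+ k)%:E)%E.
Proof.
rewrite (integral_level m_ge2 m_le mu_haar point (@level_h k)) lee_fin avgZ.
apply: le_trans (ler_wpM2l (powR_ge0 _ _) (avg_zeros R m_ge2 m_le point (leqnn (al k)))) _.
have y0 : 0 <= u k * M (al k) by exact: mulr_ge0.
have x0 : 0 <= 2 * b by exact: mulr_ge0.
rewrite -[2 * b * _ * _]mulrA (powRM _ x0 y0).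
rewrite (_ : _ * _ * (b / _) = (2 * b) `^ p * b * ((u k * M (al k)) `^ p / M (al k))); last by ring.
by rewrite ler_wpM2l// mulr_ge0 ?powR_ge0.
Qed.

Lemma hardy_mart_block : hardy mu p (mart block_coef).
Proof.
split; first exact: mart_martingale.
rewrite /hardy_norm unlock; apply: poweR_lty.
(* Subadditivity of the power [p <= 1] applies to the finite sums bounding each order; passing to
   [p]-th roots lets the supremum be handled order by order. *)
have ser x : (`|maximal_fun (mart block_coef) x| `^ p <= \sum_(0 <= k <oo) (h k x)%:E)%E.
  set S := (\sum_(0 <= k <oo) _)%E.
  have S0 : (0 <= S)%E by apply: nneseries_ge0 => k _ _; rewrite lee_fin.
  rewrite gee0_abs ?maximal_fun_ge0//.
  have -> : S = ((S `^ p^-1) `^ p)%E by rewrite -poweRrM mulVf ?gt_eqF// poweRe1.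
  apply: gt0_ler_poweR; rewrite ?(ltW p_gt0)//.
  - by rewrite in_itv /= maximal_fun_ge0 leey.
  - by rewrite in_itv /= poweR_ge0 leey.
  apply: ge_ereal_sup => _ [n _ <-].
  have -> : (`|mart block_coef n x|c)%:E = (((`|mart block_coef n x|c `^ p)%:E) `^ p^-1)%E.
    by rewrite poweR_EFin -powRrM mulfV ?gt_eqF// powRr1// normc_ge0.
  apply: gt0_ler_poweR; rewrite ?invr_ge0 ?(ltW p_gt0)//.
  - by rewrite in_itv /= lee_fin powR_ge0 leey.
  - by rewrite in_itv /= S0 leey.
  apply: (@le_trans _ _ (\sum_(0 <= k < n) (h k x)%:E)%E); last first.
    by apply: nneseries_lim_ge => k _ _; rewrite lee_fin.
  rewrite sumEFin lee_fin big_mkord.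
  apply: (@le_trans _ _ ((\sum_(k < n) 2 * b * u k * M (al k) * (zeros (al k) (al k) x)%:R) `^ p)).
    apply: ge0_ler_powR; rewrite ?nnegrE ?(ltW p_gt0) ?normc_ge0//.
      by apply: sumr_ge0 => k _; apply: mulr_ge0.
    exact: normc_mart_block.
  apply: le_trans (powR_sum_le _ _ _) _ => [|k _|]; first by rewrite p_gt0 p_le1.
    exact: mulr_ge0.
  apply: ler_sum => k _; rewrite /h powRM//.
  by case: zeros; rewrite ?powR1 ?powR0 ?gt_eqF.
have mh k : measurable_fun (setT : set G) (fun x => (h k x)%:E : \bar R).
  by apply/measurable_EFinP; exact (level_measurable_fun m_ge2 m_le (@level_h k)).
apply: (@le_lt_trans _ _ (\int[mu]_x (\sum_(0 <= k <oo) (h k x)%:E))%E).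
  apply: ge0_le_integral => //.
  - by move=> x _; exact: poweR_ge0.
  - apply: (measurableT_comp (measurable_poweR _)); apply: measurableT_comp => //.
    exact: measurable_maximal_fun.
  - by apply: ge0_emeasurable_sum => // k x _ _; rewrite lee_fin.
rewrite integral_nneseries//; last by move=> k x _; rewrite lee_fin.
apply: (@le_lt_trans _ _ ((2 * b) `^ p * b * 2)%:E); last exact: ltry.
apply: lime_le.
  by apply: is_cvg_nneseries => k _ _; apply: integral_ge0 => x _; rewrite lee_fin.
apply: nearW => n; apply: (@le_trans _ _ (\sum_(0 <= k < n) ((2 * b) `^ p * b * 2^-1 ^+ k)%:E)%E).
  by apply: lee_sum => k _; exact: integral_h.
rewrite sumEFin lee_fin -mulr_sumr ler_wpM2l ?mulr_ge0 ?powR_ge0// big_mkord.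
elim: n => [|n IH]; first by rewrite big_ord0.
by rewrite big_ord_recl expr0; under eq_bigr do rewrite exprS; rewrite -mulr_sumr; lra.
Qed.

Lemma sup_weak_Lnorm_block :
  ereal_sup [set weak_Lnorm mu p (Tmean_abs mu q (mart block_coef) n)
            | n in [set n | (0 < n)%N]] = +oo%E.
Proof.
apply/eqyP => A A0.
pose k := (Num.bound A).+1.
apply: (@le_trans _ _ (weak_Lnorm mu p (Tmean_abs mu q (mart block_coef) (vbase m (al k)).+2))); last first.
  by apply: ereal_sup_ubound; exists (vbase m (al k)).+2.
have Ak : A < k%:R.
  by apply: lt_trans (archi_boundP (ltW A0)) _; rewrite ltr_nat.
apply: ereal_sup_ge; exists (A%:E * poweR (mu [set x | (A%:E <
   `|Tmean_abs mu q (mart block_coef) (vbase m (al k)).+2 x|)%E]) p^-1)%E; first by exists A.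
(* The mean exceeds [A] at every point, so the level set has measure 1 and the weak norm is at least
   [A]. *)
rewrite (_ : [set x | _] = setT).
  by rewrite [X in poweR X]probability_setT poweR1r mule1.
apply/seteqP; split => // x _ /=.
apply: (@lt_le_trans _ _ (k%:R)%:E); first by rewrite lte_fin.
by rewrite lee_fin (le_trans (normc_Tmean_ge k x))// ler_norm.
Qed.

End blocks.

End counterexample.

Theorem mainTheorem10 (R : realType) (m : nat -> nat)
    (m_ge2 : forall k, (2 <= m k)%N)
    (m_bounded : exists N, forall k, (m k <= N)%N)
    (mu : probability (vilenkin m) R) (mu_haar : haar mu)
    (q : nat -> R) (q_ge0 : forall k, 0 <= q k)
    (q_noninc : nonincreasing_seq q) (q0_gt0 : 0 < q 0%N) :
  (exists C : R, forall F : nat -> vilenkin m -> R[i],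
     hardy mu (2^-1) F ->
     (weak_Lnorm mu (2^-1) (Tmaximal mu q F) <= C%:E * hardy_norm mu (2^-1) F)%E)
  /\
  (forall p : R, 0 < p < 2^-1 ->
     (exists c : R, 0 < c /\
        forall n : nat, (0 < n)%N -> c / n%:R <= q n.+1 / Tweight q n.+2) ->
     exists F : nat -> vilenkin m -> R[i],
       hardy mu p F /\
       ereal_sup [set weak_Lnorm mu p (Tmean_abs mu q F n)
                 | n in [set n | (0 < n)%N]] = +oo%E).
Proof.
have [B m_le] := m_bounded; split.
  by eexists => F [mF Ffin]; exact: (Tmaximal_weak_type m_ge2 m_le mu_haar q_ge0 q_noninc q0_gt0 mF Ffin).
move=> p p_bounds [c [c_gt0 q_lower]].
have [al [P [al_incr P0 P_ge0 PS u_small]]] := block_sequences m_ge2 p_bounds c_gt0.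
exists (mart (block_coef m c al P)); split.
  exact: (hardy_mart_block m_ge2 m_le mu_haar p_bounds c_gt0 al_incr P_ge0 u_small).
exact: (sup_weak_Lnorm_block m_ge2 m_le mu_haar p q_ge0 q0_gt0 c_gt0 q_lower al_incr P0 P_ge0 PS).
Qed.
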